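(* Let $(\mathcal{M},\varphi_1,\xi_1,\eta_1,g)$ be a pseudo-Riemannian manifold with an almost contact metric structure (in the sense fixed in the context). The following statements are equivalent: (i) The manifold belongs to the class $\mathcal{W}_2\oplus\mathcal{W}_4\oplus\mathcal{W}_9\oplus\mathcal{W}_{10}\oplus\mathcal{W}_{11}$, which is determined by the identity $$F_1(\varphi_1 x,y,z)+F_1(\varphi_1 y,x,z)+F_1(x,y,\varphi_1 z)+F_1(y,x,\varphi_1 z)=0$$ for all vector fields $x,y,z$ on $\mathcal{M}$. (ii) The associated Nijenhuis tensor $\widehat N_1$ vanishes and $\xi_1$ is a Killing vector field. (iii) The tensor $\{\varphi_1,\varphi_1\}$ vanishes and $\xi_1$ is a Killing vector field. (iv) The Nijenhuis tensor $N_1$ (as a $(0,3)$-tensor) is a 3-form and $\xi_1$ is a Killing vector field. (v) There exists a natural connection $D^1$ with totally skew-symmetric torsion for the structure $(\varphi_1,\xi_1,\eta_1,g)$, and this connection is unique.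
   Context: Almost contact metric structure: $\varphi_1$ is an endomorphism of the tangent bundle, $\xi_1$ a vector field, $\eta_1$ a 1-form and $g$ a pseudo-Riemannian metric with $$\varphi_1^2=-I+\xi_1\otimes\eta_1,\quad \varphi_1\xi_1=0,\quad \eta_1\circ\varphi_1=0,\quad \eta_1(\xi_1)=1,\quad g(\varphi_1x,\varphi_1y)=g(x,y)+\eta_1(x)\eta_1(y).$$ (Here $(\xi_1\otimes\eta_1)(x)=\eta_1(x)\xi_1$; consequently $g(\xi_1,\xi_1)=-1$ and $\eta_1(x)=-g(\xi_1,x)$.) Let $\nabla$ be the Levi-Civita connection of $g$ and $F_1(x,y,z)=g\big((\nabla_x\varphi_1)y,z\big)$. The class $\mathcal{W}_2\oplus\mathcal{W}_4\oplus\mathcal{W}_9\oplus\mathcal{W}_{10}\oplus\mathcal{W}_{11}$ (named after basic classes of the Alexiev–Ganchev classification of almost contact metric manifolds) is the class of manifolds for which the identity in (i) holds. Nijenhuis tensor: $N_1=[\varphi_1,\varphi_1]+\xi_1\otimes \mathrm{d}\eta_1$, where $[\varphi_1,\varphi_1](x,y)=\varphi_1^2[x,y]+[\varphi_1x,\varphi_1y]-\varphi_1[\varphi_1x,y]-\varphi_1[x,\varphi_1y]$ and $\mathrm{d}\eta_1(x,y)=(\nabla_x\eta_1)y-(\nabla_y\eta_1)x$. As a $(0,3)$-tensor, $N_1(x,y,z)=g(N_1(x,y),z)$. Symmetric braces: $\{x,y\}=\nabla_xy+\nabla_yx$ for vector fields $x,y$. Define the symmetric $(1,2)$-tensor $$\{\varphi_1,\varphi_1\}(x,y)=\{\varphi_1x,\varphi_1y\}+\varphi_1^2\{x,y\}-\varphi_1\{\varphi_1x,y\}-\varphi_1\{x,\varphi_1y\}$$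 and the associated Nijenhuis tensor $\widehat N_1=\{\varphi_1,\varphi_1\}-\xi_1\otimes\mathfrak{L}_{\xi_1}g$, i.e. $\widehat N_1(x,y)=\{\varphi_1,\varphi_1\}(x,y)-(\mathfrak{L}_{\xi_1}g)(x,y)\,\xi_1$, where $\mathfrak{L}$ is the Lie derivative. A linear connection $D$ is a natural connection for $(\varphi_1,\xi_1,\eta_1,g)$ if $D\varphi_1=D\xi_1=D\eta_1=Dg=0$. Its torsion $T$ is totally skew-symmetric if $T(x,y,z)=g(T(x,y),z)$ is a 3-form. *)

(* Defs.v *)
From HB Require Import structures.
From mathcomp Require Import all_boot all_order all_algebra.
From mathcomp Require Import ring.
From mathcomp Require Import all_classical all_reals all_analysis.
Set Implicit Arguments.
Unset Strict Implicit.
Unset Printing Implicit Defensive.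
Import Order.TTheory GRing.Theory Num.Theory.
Import numFieldNormedType.Exports.
Local Open Scope classical_set_scope.
Local Open Scope ring_scope.

Lemma near_eq_differentiable {R : realType} {V W : normedModType R}
    (f h : V -> W) x :
  {near x, f =1 h} -> differentiable f x -> differentiable h x.
Proof.
move=> fh df.
have cd : continuous ('d f x) by exact: diff_continuous.
have E : h \o shift x = cst (h x) + 'd f x +o_ 0 id.
  apply/eqaddoP => e e0.
  have := diff_locally df => /eqaddoP /(_ e e0) H.
  have fhx : f x = h x := nbhs_singleton fh.
  have fh0 : \forall y \near 0, f (y + x) = h (y + x).
    have : \forall y \near x, f y = h y by exact: fh.
    by rewrite (near_shift 0) /= subr0.
  near=> y.
  have := near H y; rewrite /= => Hy.
  rewrite !fctE /= -(near fh0 y) // -fhx.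
  by apply: (near H y).
apply/diff_locallyP.
by rewrite (diff_unique cd E).
Unshelve. all: by end_near. Qed.

Section smooth_maps.
Context {R : realType} {V W : normedModType R}.
Implicit Types (U : set V) (f : V -> W).

(* Class C^k on an open subset U of a finite-dimensional space V.  U must be
   open because [differentiable] and ['D_v] look at full neighborhoods. *)
Fixpoint C_on (k : nat) U f : Prop :=
  if k is k'.+1 then
    (forall x, U x -> differentiable f x) /\ (forall v, C_on k' U ('D_v f))
  else forall x, U x -> {for x, continuous f}.

Definition smooth_on U f := forall k, C_on k U f.

Lemma C_onW k U f : C_on k.+1 U f -> C_on k U f.
Proof.
elim: k f => [|k IH] f [df Df].
  by move=> x Ux; apply: differentiable_continuous; exact: df.
by split=> // v; apply: IH.
Qed.

Lemma eq_C_on k U f h : open U -> (forall x, U x -> f x = h x) ->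
  C_on k U f -> C_on k U h.
Proof.
move=> oU; elim: k f h => [|k IH] f h fh.
  move=> cf x Ux.
  have nfh : {near x, f =1 h}.
    by apply: filterS fh _; exact: open_nbhs_nbhs.
  rewrite /prop_for /continuous_at -(fh x Ux).
  by apply: cvg_trans (cf x Ux); exact: near_eq_cvg.
have nfh x : U x -> {near x, f =1 h}.
  by move=> Ux; apply: filterS fh _; exact: open_nbhs_nbhs.
move=> [df Df]; split=> [x Ux|v].
  by apply: near_eq_differentiable (df x Ux); exact: nfh.
apply: IH (Df v) => x Ux.
by apply: near_eq_derive; exact: nfh.
Qed.

End smooth_maps.

Section smooth_fun_algebra.
Context {R : realType} {V : normedModType R}.
Implicit Types (U : set V) (f h : V -> R).

Lemma C_on_cst k U (a : R) : C_on k U (cst a : V -> R).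
Proof.
elim: k a => [|k IH] a /=; first by move=> x _; exact: cst_continuous.
split=> [x _|v]; first exact: differentiable_cst.
rewrite (_ : 'D_v _ = cst 0)//; apply/funext => x; exact: derive_cst.
Qed.

Lemma C_onD k U f h : open U ->
  C_on k U f -> C_on k U h -> C_on k U (f + h).
Proof.
move=> oU; elim: k f h => [|k IH] f h.
  by move=> cf ch x Ux; apply: cvgD; [exact: cf|exact: ch].
move=> [df Df] [dh Dh]; split=> [x Ux|v].
  by apply: differentiableD; [exact: df|exact: dh].
apply: (@eq_C_on _ _ _ _ _ ('D_v f + 'D_v h)) => //; last first.
  by apply: IH; [exact: Df|exact: Dh].
by move=> x Ux; rewrite deriveD//; apply: diff_derivable; (exact: df || exact: dh).
Qed.

Lemma C_onM k U f h : open U ->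
  C_on k U f -> C_on k U h -> C_on k U (f * h).
Proof.
move=> oU; elim: k f h => [|k IH] f h.
  by move=> cf ch x Ux; apply: cvgM; [exact: cf|exact: ch].
move=> fS hS; have fk := C_onW fS; have hk := C_onW hS.
move: fS hS => [df Df] [dh Dh]; split=> [x Ux|v].
  by apply: differentiableM; [exact: df|exact: dh].
apply: (@eq_C_on _ _ _ _ _ (f * 'D_v h + h * 'D_v f)) => //.
  by move=> x Ux; rewrite deriveM//; apply: diff_derivable;
    (exact: df || exact: dh).
by apply: C_onD => //; apply: IH => //; [exact: Dh|exact: Df].
Qed.

End smooth_fun_algebra.

(* [chart] and [chart_inv] are total functions whose values outside
   [chart_dom i], respectively outside [chart i @` chart_dom i], are
   irrelevant.  The atlas is not required to be maximal: enlarging it to the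
   maximal one changes neither the smooth functions nor the vector fields. *)
Record smooth_manifold (R : realType) (n : nat) := SmoothManifold {
  carrier :> topologicalType ;
  carrier_hausdorff : hausdorff_space carrier ;
  carrier_second_countable : @second_countable carrier ;
  chart_index : Type ;
  chart_dom : chart_index -> set carrier ;
  chart : chart_index -> carrier -> 'rV[R]_n ;
  chart_inv : chart_index -> 'rV[R]_n -> carrier ;
  chart_cover : forall p, exists i, chart_dom i p ;
  chart_dom_open : forall i, open (chart_dom i) ;
  chart_img_open : forall i, open (chart i @` chart_dom i) ;
  chartK : forall i p, chart_dom i p -> chart_inv i (chart i p) = p ;
  chart_continuous : forall i p, chart_dom i p -> {for p, continuous (chart i)} ;
  chart_inv_continuous : forall i u, (chart i @` chart_dom i) u ->
    {for u, continuous (chart_inv i)} ;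
  chart_transition : forall i j,
    smooth_on (chart i @` (chart_dom i `&` chart_dom j))
      (chart j \o chart_inv i)
}.

Section smooth_functions.
Context {R : realType} {n : nat} (M : smooth_manifold R n).

Definition is_smooth : {pred M -> R} := fun f =>
  `[< forall i : chart_index M,
        smooth_on (chart i @` chart_dom i) (f \o chart_inv i) >].

Record smooth_fun := SmoothFun {
  smooth_fun_val :> M -> R ;
  _ : smooth_fun_val \in is_smooth
}.

HB.instance Definition _ := [isSub for smooth_fun_val].
HB.instance Definition _ := [Choice of smooth_fun by <:].

Lemma is_smooth_cst (a : R) : (cst a : M -> R) \in is_smooth.
Proof. by apply/asboolP => i k; exact: C_on_cst. Qed.

Lemma is_smooth_subring_closed : subring_closed is_smooth.
Proof.
have MM f h : f \in is_smooth -> h \in is_smooth -> f * h \in is_smooth.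
  move=> /asboolP sf /asboolP sh; apply/asboolP => i k.
  by apply: C_onM; [exact: chart_img_open|exact: sf|exact: sh].
split=> [|f h fS hS|//]; first exact: is_smooth_cst.
have -> : f - h = f + cst (-1) * h.
  by apply/funext => p; rewrite !fctE mulN1r.
move: fS (MM _ _ (is_smooth_cst (-1)) hS) => /asboolP sf /asboolP sh.
apply/asboolP => i k.
by apply: C_onD; [exact: chart_img_open|exact: sf|exact: sh].
Qed.

HB.instance Definition _ :=
  GRing.isSubringClosed.Build _ is_smooth is_smooth_subring_closed.
HB.instance Definition _ := GRing.SubChoice_isSubComPzRing.Build _ _ smooth_fun
  is_smooth_subring_closed.

Definition constant_fun (a : R) : smooth_fun := SmoothFun (is_smooth_cst a).

End smooth_functions.

Section vector_fields.
Context {R : realType} {n : nat} (M : smooth_manifold R n).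

(* Vector fields are the R-linear derivations of the algebra of smooth
   functions; the scalar [a : R] acts as multiplication by a constant. *)
Definition is_derivation : {pred smooth_fun M -> smooth_fun M} := fun X =>
  `[< (forall (a : R) f h, X (constant_fun M a * f + h)
                           = constant_fun M a * X f + X h) /\
      (forall f h, X (f * h) = X f * h + f * X h) >].

Record vector_field := VectorField {
  vector_field_val :> smooth_fun M -> smooth_fun M ;
  _ : vector_field_val \in is_derivation
}.

HB.instance Definition _ := [isSub for vector_field_val].
HB.instance Definition _ := [Choice of vector_field by <:].

Lemma is_derivation_zmod_closed : zmod_closed is_derivation.
Proof.
split=> [|X Y /asboolP[lX mX] /asboolP[lY mY]].
  by apply/asboolP; split=> [a f h|f h]; rewrite /GRing.zero /= ?mulr0 ?mul0r addr0.
apply/asboolP; split=> [a f h|f h]; rewrite !fctE.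
  by rewrite lX lY mulrBr opprD addrACA.
by rewrite mX mY mulrBl mulrBr opprD addrACA.
Qed.

HB.instance Definition _ :=
  GRing.isZmodClosed.Build _ is_derivation is_derivation_zmod_closed.
HB.instance Definition _ := [SubChoice_isSubZmodule of vector_field by <:].

Lemma derivation_cst (X : vector_field) (a : R) f h :
  X (constant_fun M a * f + h) = constant_fun M a * X f + X h.
Proof. by case: X => X /= /asboolP[]. Qed.

Lemma derivationM (X : vector_field) f h : X (f * h) = X f * h + f * X h.
Proof. by case: X => X /= /asboolP[]. Qed.

Lemma derivationD (X : vector_field) f h : X (f + h) = X f + X h.
Proof.
have := derivation_cst X 1 f h.
by rewrite (_ : constant_fun M 1 = 1) ?mul1r//; exact: val_inj.
Qed.

Lemma derivationZ (X : vector_field) a f :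
  X (constant_fun M a * f) = constant_fun M a * X f.
Proof.
have X0 : X 0 = 0 by apply: (addrI (X 0)); rewrite -derivationD !addr0.
by rewrite -[in LHS](addr0 (_ * f)) derivation_cst X0 addr0.
Qed.

Fact scale_is_derivation (f : smooth_fun M) (X : vector_field) :
  (fun h => f * X h) \in is_derivation.
Proof.
apply/asboolP; split=> [a h k|h k].
  by rewrite derivation_cst mulrDr mulrCA.
by rewrite derivationM mulrDr mulrA mulrCA.
Qed.

Definition vector_field_scale f X := VectorField (scale_is_derivation f X).

Fact vector_field_scaleA f h X :
  vector_field_scale f (vector_field_scale h X) = vector_field_scale (f * h) X.
Proof. by apply/val_inj/funext => k /=; rewrite mulrA. Qed.

Fact vector_field_scale1 : left_id 1 vector_field_scale.
Proof. by move=> X; apply/val_inj/funext => k /=; rewrite mul1r. Qed.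

Fact vector_field_scaleDr : right_distributive vector_field_scale +%R.
Proof. by move=> f X Y; apply/val_inj/funext => k /=; rewrite mulrDr. Qed.

Fact vector_field_scaleDl X :
  {morph vector_field_scale^~ X : f h / f + h}.
Proof. by move=> f h; apply/val_inj/funext => k /=; rewrite mulrDl. Qed.

HB.instance Definition _ := GRing.Zmodule_isLmodule.Build (smooth_fun M)
  vector_field vector_field_scaleA vector_field_scale1
  vector_field_scaleDr vector_field_scaleDl.

Fact bracket_is_derivation (X Y : vector_field) :
  (fun f => X (Y f) - Y (X f)) \in is_derivation.
Proof.
apply/asboolP; split=> [a f h|f h].
  by rewrite !derivation_cst mulrBr opprD addrACA.
rewrite !(derivationM, derivationD).
ring.
Qed.

Definition bracket X Y := VectorField (bracket_is_derivation X Y).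

End vector_fields.

(* Tensor fields are represented by their action on global vector fields, as
   maps linear over [smooth_fun M]: an endomorphism of the tangent bundle is a
   [{linear vector_field M -> vector_field M}], a 1-form is a
   [{scalar vector_field M}]. *)
Section tensors.
Context {R : realType} {n : nat} {M : smooth_manifold R n}.
Local Notation A := (smooth_fun M).
Local Notation X := (vector_field M).
Implicit Types (x y z xi : X) (phi : X -> X) (eta : X -> A) (g : X -> X -> A).

(* The tangent vector of [x] at [p] is [f |-> x f p], so the last clause says
   that the bilinear form induced by [g] on each tangent space has trivial
   kernel. *)
Definition pseudo_riemannian_metric g : Prop :=
  [/\ forall x, scalar (g x),
      forall x y, g x y = g y x &
      forall (p : M) x, (forall y, g x y p = 0) -> forall f : A, x f p = 0].

Definition three_form (T : X -> X -> X -> A) : Prop :=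
  [/\ forall y z, scalar (fun x => T x y z),
      forall x z, scalar (fun y => T x y z),
      forall x y, scalar (fun z => T x y z),
      forall x y z, T y x z = - T x y z &
      forall x y z, T x z y = - T x y z].

Record almost_contact_metric phi xi eta g : Prop := AlmostContactMetric {
  acm_phi2 : forall x, phi (phi x) = - x + eta x *: xi ;
  acm_phi_xi : phi xi = 0 ;
  acm_eta_phi : forall x, eta (phi x) = 0 ;
  acm_eta_xi : eta xi = 1 ;
  acm_metric : forall x y, g (phi x) (phi y) = g x y + eta x * eta y
}.

Definition lie_derivative_metric xi g x y : A :=
  xi (g x y) - g (bracket xi x) y - g x (bracket xi y).

Definition killing xi g : Prop :=
  forall x y, lie_derivative_metric xi g x y = 0.

Section connections.
Variable D : X -> X -> X.

Record linear_connection : Prop := LinearConnection {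
  connection_linear : forall y, linear (fun x => D x y) ;
  connectionD : forall x y z, D x (y + z) = D x y + D x z ;
  connectionM : forall x (f : A) y, D x (f *: y) = x f *: y + f *: D x y
}.

Definition torsion x y : X := D x y - D y x - bracket x y.

Definition cov_endo phi x y : X := D x (phi y) - phi (D x y).
Definition cov_form eta x y : A := x (eta y) - eta (D x y).
Definition cov_metric g x y z : A := x (g y z) - g (D x y) z - g y (D x z).

Definition levi_civita g : Prop :=
  [/\ linear_connection,
      forall x y z, cov_metric g x y z = 0 &
      forall x y, torsion x y = 0].

Definition natural_connection phi xi eta g : Prop :=
  [/\ linear_connection,
      forall x y, cov_endo phi x y = 0,
      forall x, D x xi = 0,
      forall x y, cov_form eta x y = 0 &
      forall x y z, cov_metric g x y z = 0].

Definition skew_torsion g : Prop :=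
  three_form (fun x y z => g (torsion x y) z).

End connections.

Section levi_civita_tensors.
Variables (nabla : X -> X -> X) (phi : X -> X) (xi : X) (eta : X -> A).
Variable g : X -> X -> A.

Definition fundamental_tensor x y z : A := g (cov_endo nabla phi x y) z.

Definition class_W2_W4_W9_W10_W11 : Prop := forall x y z,
  fundamental_tensor (phi x) y z + fundamental_tensor (phi y) x z
  + fundamental_tensor x y (phi z) + fundamental_tensor y x (phi z) = 0.

Definition ext_deriv x y : A := cov_form nabla eta x y - cov_form nabla eta y x.

Definition phi_bracket x y : X :=
  phi (phi (bracket x y)) + bracket (phi x) (phi y)
  - phi (bracket (phi x) y) - phi (bracket x (phi y)).

Definition nijenhuis x y : X := phi_bracket x y + ext_deriv x y *: xi.

Definition brace x y : X := nabla x y + nabla y x.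

Definition phi_brace x y : X :=
  brace (phi x) (phi y) + phi (phi (brace x y))
  - phi (brace (phi x) y) - phi (brace x (phi y)).

Definition assoc_nijenhuis x y : X :=
  phi_brace x y - lie_derivative_metric xi g x y *: xi.

End levi_civita_tensors.

End tensors.

(* Main.v *)
(* Write F(x,y,z) = g((nabla_x phi) y, z), w(x,y) = g(nabla_x xi, y) and
   B(x,y,z) = F(phi x,y,z) + F(x,y,phi z) + w(x,y) eta(z), which is always
   skew-symmetric in y and z.  The left-hand side of (i) is
   g({phi,phi}(x,y), z); putting xi into it shows that w is skew, i.e. that xi
   is Killing.  For Killing xi, {phi,phi} is the symmetrization and N the
   antisymmetrization of B in x and y, so both (iii) and (iv) say that B is a
   3-form.  A natural connection with skew torsion T is nabla + T/2, and
   D phi = 0, D xi = 0 amount to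
     2 F(x,y,z) = - T(x,phi y,z) - T(x,y,phi z),   2 w(x,z) = - T(x,xi,z).
   These equations force (i) and determine T; if B is a 3-form they are solved
   by the cyclic sum of F(x,y,phi z) + w(x,y) eta(z) minus B.

   This T is a 3-form of which the last argument occurs as a direction of
   differentiation, so turning it into a connection needs the musical
   isomorphism.  As vector fields are derivations of the algebra of smooth
   functions, this rests on Hadamard's lemma, which gives local frames; the
   local solutions of g(x,.) = alpha are unique, hence glue without a partition
   of unity. *)
From HB Require Import structures.
Require Import Defs.
From mathcomp Require Import all_boot all_order all_algebra.
From mathcomp Require Import ring lra.
From mathcomp Require Import all_classical all_reals all_analysis.

Set Implicit Arguments.
Unset Strict Implicit.
Unset Printing Implicit Defensive.
Import Order.TTheory GRing.Theory Num.Theory.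
Import numFieldNormedType.Exports.
Local Open Scope classical_set_scope.
Local Open Scope ring_scope.

(** * Calculus of smooth maps *)

Section smooth_calculus.
Context {R : realType} {V W : normedModType R}.
Implicit Types U : set V.

Lemma C_on_sub k U U' (f : V -> W) : U' `<=` U -> C_on k U f -> C_on k U' f.
Proof.
move=> UU'; elim: k f => [|k IH] f /=; first by move=> cf x /UU'; exact: cf.
by move=> [df Df]; split=> [x /UU'|v]; [exact: df|exact: IH].
Qed.

(** [differentiable] and ['D_v] look at full neighbourhoods of a point, so [C_on] is a condition at
    each point separately and may be checked on any set containing the point. *)
Lemma C_on_local k U (f : V -> W) :
  (forall x, U x -> exists B, B x /\ C_on k B f) -> C_on k U f.
Proof.
elim: k f => [|k IH] f /= H; first by move=> x /H [B [Bx]]; apply.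
split=> [x /H [B [Bx [dB _]]]|v]; first exact: dB.
by apply: IH => x /H [B [Bx [_ DB]]]; exists B; split.
Qed.

Lemma smooth_derive U (f : V -> W) v : smooth_on U f -> smooth_on U ('D_v f).
Proof. by move=> sf k; have [_ Df] := sf k.+1; exact: Df. Qed.

(** The inductive step of every smoothness proof below: the explicit formula [g v] for the
    derivative is available on [U] only, and openness of [U] lets it replace ['D_v f] at all higher
    orders. *)
Lemma C_onS k U (f : V -> W) (g : V -> V -> W) : open U ->
  (forall x, U x -> differentiable f x) ->
  (forall x v, U x -> 'D_v f x = g v x) ->
  (forall v, C_on k U (g v)) -> C_on k.+1 U f.
Proof.
move=> oU df Dfg Cg; split=> // v.
by apply: eq_C_on (Cg v) => // x Ux; rewrite Dfg.
Qed.

End smooth_calculus.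

Section smooth_scalar.
Context {R : realType} {V : normedModType R}.
Implicit Types (U : set V) (f h : V -> R).

Lemma C_on_sum (I : finType) (P : pred I) k U (f : I -> V -> R) : open U ->
  (forall i, C_on k U (f i)) -> C_on k U (fun x => \sum_(i | P i) f i x).
Proof.
move=> oU Cf; rewrite (_ : (fun x => _) = \sum_(i | P i) f i); last first.
  by apply/funext => x; rewrite fct_sumE.
by elim/big_ind : _ => [|g h|i _]; [exact: C_on_cst|exact: C_onD|exact: Cf].
Qed.

Lemma smoothM U f h : open U ->
  smooth_on U f -> smooth_on U h -> smooth_on U (fun x => f x * h x).
Proof. by move=> oU sf sh k; apply: C_onM; [exact: oU|exact: sf|exact: sh]. Qed.

Lemma smoothB U f h : open U ->
  smooth_on U f -> smooth_on U h -> smooth_on U (fun x => f x - h x).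
Proof.
move=> oU sf sh k.
apply: (@eq_C_on _ _ _ _ _ (f + cst (-1) * h)) => //.
  by move=> x _; rewrite !fctE mulN1r.
apply: C_onD; [exact: oU|exact: sf|].
by apply: C_onM; [exact: oU|exact: C_on_cst|exact: sh].
Qed.

Lemma smooth_prod (I : finType) U (f : I -> V -> R) : open U ->
  (forall i, smooth_on U (f i)) -> smooth_on U (fun x => \prod_i f i x).
Proof.
move=> oU Cf k; rewrite (_ : (fun x => _) = \prod_i f i); last first.
  by apply/funext => x; rewrite fct_prodE.
elim/big_ind : _ => [|g h|i _]; [exact: C_on_cst|exact: C_onM|exact: Cf].
Qed.

(** The derivative of [1/f] is a product of [1/f], [1/f] and a derivative of [f], so the induction
    hypothesis applies to it. *)
Lemma smoothV U f : open U -> (forall x, U x -> f x != 0) ->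
  smooth_on U f -> smooth_on U (fun x => (f x)^-1).
Proof.
move=> oU f0 sf; elim=> [|k IH].
  by move=> x Ux; apply: cvgV; [exact: f0|exact: (sf 0%N)].
have [df _] := sf 1%N.
apply: (@C_onS _ _ _ _ _ _ (fun v =>
  cst (-1) * ((fun x => (f x)^-1) * ((fun x => (f x)^-1) * 'D_v f)))) => //.
- by move=> x Ux; apply: differentiableV; [exact: df|exact: f0].
- move=> x v Ux; rewrite deriveV ?f0//; last exact/diff_derivable/df.
  by rewrite !fctE mulN1r /GRing.scale/= mulNr expr2 invfM mulrA.
- move=> v; apply: C_onM => //; first exact: C_on_cst.
  do 2 (apply: C_onM => //).
  exact: (smooth_derive v sf).
Qed.

End smooth_scalar.

Section coordinates.
Context {R : realType} {n : nat}.
Implicit Types (U : set 'rV[R]_n).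

Lemma rV_sum_delta (v : 'rV[R]_n) : v = \sum_a v 0 a *: 'e_a.
Proof.
apply/rowP => j; rewrite summxE (bigD1 j)//= !mxE !eqxx mulr1 big1 ?addr0// => i ij.
by rewrite !mxE eqxx eq_sym (negPf ij) mulr0.
Qed.

Lemma derive_coordE (W : normedModType R) (f : 'rV[R]_n -> W) x v :
  differentiable f x -> 'D_v f x = \sum_a v 0 a *: 'D_('e_a) f x.
Proof.
move=> df; rewrite deriveE// {1}(rV_sum_delta v) linear_sum; apply: eq_bigr => a _.
by rewrite linearZ deriveE.
Qed.

Lemma derive_entry (V : normedModType R) m (f : V -> 'rV[R]_m) x v a :
  derivable f x v -> 'D_v (fun y => f y 0 a) x = ('D_v f x) 0 a.
Proof. by move=> /derive_mx ->; rewrite mxE. Qed.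

Lemma derive_coord (x v : 'rV[R]_n) a : 'D_v (fun y : 'rV[R]_n => y 0 a) x = v 0 a.
Proof. by rewrite (@derive_entry _ _ id) ?derive_id//; exact: derivable_id. Qed.

Lemma smooth_coord U a : smooth_on U (fun x : 'rV[R]_n => x 0 a).
Proof.
case=> [|k]; first by move=> x _; exact: coord_continuous.
apply: (@C_on_sub _ _ _ _ setT) => //.
refine (@C_onS R 'rV[R]_n R k setT _ (fun v => cst (v 0 a)) _ _ _ _).
- exact: openT.
- by move=> x _; exact: differentiable_coord.
- by move=> x v _; rewrite derive_coord.
- by move=> v; exact: C_on_cst.
Qed.

End coordinates.

Section composition.
Context {R : realType} {n : nat}.

Lemma C_on_entry (V : normedModType R) k (U : set V) (f : V -> 'rV[R]_n) a :
  open U -> C_on k U f -> C_on k U (fun x => f x 0 a).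
Proof.
move=> oU; elim: k f => [|k IH] f.
  move=> cf x Ux; apply: (@continuous_comp _ _ _ f (fun y : 'rV[R]_n => y 0 a)).
    exact: cf.
  exact: coord_continuous.
move=> [df Df]; apply: (@C_onS _ _ R _ _ _ (fun v x => 'D_v f x 0 a)) => //.
- move=> x Ux; apply: (@differentiable_comp _ _ _ _ f (fun y : 'rV[R]_n => y 0 a)).
    exact: df.
  exact: differentiable_coord.
- by move=> x v Ux; apply: derive_entry; exact/diff_derivable/df.
- by move=> v; apply: IH; exact: Df.
Qed.

(** By the chain rule the derivative is a sum of entries of ['D_v t] times partial derivatives of
    [f] composed with the same [t]; hence the induction on the order with [f] generalized. *)
Lemma smooth_comp (V : normedModType R) (U : set V) (U' : set 'rV[R]_n)
    (t : V -> 'rV[R]_n) (f : 'rV[R]_n -> R) : open U ->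
  (forall x, U x -> U' (t x)) ->
  smooth_on U t -> smooth_on U' f -> smooth_on U (f \o t).
Proof.
move=> oU tU st sf k; elim: k f sf => [|k IH] f sf.
  move=> x Ux; apply: continuous_comp; first exact: (st 0%N).
  by apply: (sf 0%N); exact: tU.
have [dt _] := st 1%N; have [df _] := sf 1%N.
apply: (@C_onS _ _ R _ _ _
  (fun v x => \sum_a (('D_v t x) 0 a * ('D_('e_a) f \o t) x))) => //.
- by move=> x Ux; apply: differentiable_comp; [exact: dt|exact/df/tU].
- move=> x v Ux; rewrite deriveE; last first.
    by apply: differentiable_comp; [exact: dt|exact/df/tU].
  rewrite diff_comp; [|exact: dt|exact/df/tU].
  rewrite /= -deriveE; last exact/df/tU.
  rewrite derive_coordE; last exact/df/tU.
  by rewrite -deriveE//; exact: dt.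
- move=> v; apply: C_on_sum => // a; apply: C_onM => //.
    by apply: C_on_entry => //; exact: (smooth_derive v st).
  by apply: IH; exact: smooth_derive.
Qed.

End composition.

(** * Hadamard's lemma *)

Section lines.
Context {R : realType} {V : normedModType R}.

Lemma is_derive_line (W : normedModType R) (f : V -> W) x v (s : R) :
  differentiable f (x + s *: v) ->
  is_derive s 1 (fun t => f (x + t *: v)) ('D_v f (x + s *: v)).
Proof.
move=> df; have /= := @diff_derivable _ _ _ _ _ v df.
have E h : f (x + (h *: (1 : R) + s) *: v) = f (h *: v + (x + s *: v)).
  by rewrite [h *: _]mulr1 scalerDl addrCA.
rewrite /derivable /derive => D; split.
  by rewrite /derivable; under eq_fun do rewrite /= E.
by rewrite /derive; under eq_fun do rewrite /= E.
Qed.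

Lemma ball_segment (p : V) r x y (t : R) : ball p r x -> ball p r y ->
  0 <= t <= 1 -> ball p r (x + t *: (y - x)).
Proof.
rewrite -!ball_normE /= => px py /andP[t0 t1].
have -> : p - (x + t *: (y - x)) = (1 - t) *: (p - x) + t *: (p - y).
  rewrite scalerBl scale1r -addrA -scalerN -scalerDr opprB addrA subrK.
  by rewrite -(opprB y x) scalerN opprD addrA.
apply: le_lt_trans (ler_normD _ _) _.
rewrite !normrZ (ger0_norm t0) ger0_norm ?subr_ge0//.
(* The strict bound is kept on the summand with factor [t], which needs [t] positive; for [t = 0]
   only the first summand remains. *)
have [->|tn0] := eqVneq t 0; first by rewrite subr0 mul0r addr0 mul1r.
have -> : r = (1 - t) * r + t * r by ring.
apply: ler_ltD; first by rewrite ler_wpM2l ?subr_ge0// ltW.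
by rewrite ltr_pM2l// lt_neqAle eq_sym tn0.
Qed.

Lemma line_continuous (x v : V) : continuous (fun t : R => x + t *: v).
Proof.
by move=> t; apply: cvgD; [exact: cvg_cst|exact: cvgZr_tmp].
Qed.

End lines.

Lemma differentiable_of_linear_bound {R : realType} {V W : normedModType R}
    (f : V -> W) u (L : {linear V -> W}) : continuous L ->
  (forall e : R, 0 < e ->
    \forall v \near (0 : V), `|f (v + u) - f u - L v| <= e * `|v|) ->
  differentiable f u /\ forall v, 'D_v f u = L v.
Proof.
move=> cL H; have E : f \o shift u = cst (f u) + L +o_ 0 id.
  apply/eqaddoP => e e0; near=> v.
  rewrite !fctE /= opprD addrA; near: v; exact: H.
have dE := diff_unique cL E.
have df : differentiable f u by apply/diff_locallyP; rewrite dE.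
by split=> // v; rewrite deriveE// dE.
Unshelve. all: by end_near. Qed.

(** * Integrals over the unit interval *)

Section integral01.
Context {R : realType}.
Local Notation mu := (@lebesgue_measure R).
Implicit Types f g : R -> R.

(** Two-sided continuity also at the end points: the integrands are functions along segments in an
    open ball, hence continuous slightly beyond both ends. *)
Definition continuous01 f := forall t : R, 0 <= t <= 1 -> {for t, continuous f}.

Definition integral01 f : R := \int[mu]_(t in `[0, 1]) f t.

Lemma continuous01_within f : continuous01 f -> {within `[0, 1], continuous f}.
Proof.
move=> cf; apply: continuous_in_subspaceT => t.
by rewrite inE /= in_itv /= => t01; exact: cf.
Qed.

Lemma continuous01_integrable f : continuous01 f ->
  mu.-integrable `[0, 1] (EFin \o f).
Proof.
move=> /continuous01_within cf; apply: continuous_compact_integrable => //.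
exact: segment_compact.
Qed.

Lemma continuous01D f g : continuous01 f -> continuous01 g ->
  continuous01 (fun t => f t + g t).
Proof. by move=> cf cg t t01; apply: cvgD; [exact: cf|exact: cg]. Qed.

Lemma continuous01M f g : continuous01 f -> continuous01 g ->
  continuous01 (fun t => f t * g t).
Proof. by move=> cf cg t t01; apply: cvgM; [exact: cf|exact: cg]. Qed.

Lemma continuous01_cst c : continuous01 (fun=> c).
Proof. by move=> t _; exact: cvg_cst. Qed.

Lemma integral01D f g : continuous01 f -> continuous01 g ->
  integral01 (fun t => f t + g t) = integral01 f + integral01 g.
Proof. by move=> cf cg; rewrite [LHS]RintegralD//; exact: continuous01_integrable. Qed.

Lemma integral01Z c f : continuous01 f ->
  integral01 (fun t => c * f t) = c * integral01 f.
Proof. by move=> cf; rewrite [LHS]RintegralZl//; exact: continuous01_integrable. Qed.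

(** Continuity is proved in the same induction because additivity of the integral asks for it at
    each step. *)
Lemma integral01_sum (I : finType) (f : I -> R -> R) :
  (forall i, continuous01 (f i)) ->
  continuous01 (fun t => \sum_i f i t) /\
  integral01 (fun t => \sum_i f i t) = \sum_i integral01 (f i).
Proof.
move=> cf; elim: (index_enum I) => [|i s [cs IH]].
  split; first by under eq_fun do rewrite big_nil; exact: continuous01_cst.
  rewrite big_nil; under [LHS]eq_Rintegral do rewrite big_nil.
  by rewrite Rintegral_cst// mul0r.
rewrite big_cons -IH -integral01D//.
have -> : (fun t => \sum_(j <- i :: s) f j t) = (fun t => f i t + \sum_(j <- s) f j t).
  by apply/funext => t; rewrite big_cons.
by split=> //; exact: continuous01D.
Qed.

Lemma integral01_cst c : integral01 (fun=> c) = c.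
Proof.
rewrite [LHS]Rintegral_cst//; transitivity (c * fine (1 : \bar R)%E); last exact: mulr1.
congr (_ * fine _); apply: etrans (lebesgue_measure_itv `[0 : R, 1]) _.
by rewrite /= lte01 sube0.
Qed.

Lemma normr_integral01_le f c : continuous01 f ->
  (forall t, 0 <= t <= 1 -> `|f t| <= c) -> `|integral01 f| <= c.
Proof.
move=> cf fc; have if_ := continuous01_integrable cf.
apply: le_trans (le_normr_Rintegral _ if_) _ => //.
rewrite -[leRHS]integral01_cst; apply: le_Rintegral => //.
- by apply: continuous01_integrable => t t01; apply: cvg_norm; exact: cf.
- exact/continuous01_integrable/continuous01_cst.
Qed.

Lemma integral01_FTC (F : R -> R) f : continuous01 f ->
  (forall t : R, 0 <= t <= 1 -> is_derive t 1 F (f t)) -> integral01 f = F 1 - F 0.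
Proof.
move=> cf dF; rewrite /integral01 /Rintegral (@continuous_FTC2 _ f F)//.
- exact: continuous01_within.
- have dF' t : 0 <= t <= 1 -> derivable F t 1 by move=> /dF; case.
  have cF t : 0 <= t <= 1 -> {for t, continuous F}.
    by move=> /dF' ?; apply/differentiable_continuous/derivable1_diffP.
  split.
  + by move=> t; rewrite in_itv /= => /andP[/ltW t0 /ltW t1]; apply: dF'; rewrite t0.
  + by apply: cvg_at_right_filter; apply: cF; rewrite lexx ler01.
  + by apply: cvg_at_left_filter; apply: cF; rewrite lexx ler01.
- move=> t; rewrite in_itv /= => /andP[/ltW t0 /ltW t1].
  by rewrite derive1E; apply: derive_val; apply: dF; rewrite t0.
Qed.

End integral01.

(** * First-order expansions uniform in the base point *)

Section strict_differentiability.
Context {R : realType} {n : nat}.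
Implicit Types (f : 'rV[R]_n -> R) (x u v : 'rV[R]_n).

Lemma entry_le_norm v a : `|v 0 a| <= `|v|.
Proof.
rewrite [leRHS]/Num.Def.normr /= mx_normrE.
exact: (le_bigmax _ (fun ij : 'I_1 * 'I_n => `|v ij.1 ij.2|) (0, a)).
Qed.

Lemma norm_sum_entries_le v (c : 'I_n -> R) (e : R) :
  (forall a, `|c a| <= e) -> `|\sum_a v 0 a * c a| <= n%:R * e * `|v|.
Proof.
move=> ce; apply: le_trans (ler_norm_sum _ _ _) _.
apply: (@le_trans _ _ (\sum_(a < n) e * `|v|)).
  by apply: ler_sum => a _; rewrite normrM mulrC ler_pM// entry_le_norm.
by rewrite sumr_const card_ord -mulrA mulr_natl.
Qed.

Lemma differentiable_of_bound f u (c : 'I_n -> R) :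
  (forall e : R, 0 < e -> \forall v \near (0 : 'rV[R]_n),
    `|f (v + u) - f u - \sum_a v 0 a * c a| <= e * `|v|) ->
  differentiable f u /\ forall v, 'D_v f u = \sum_a v 0 a * c a.
Proof.
move=> H; pose L v := \sum_a v 0 a * c a.
have Llin : linear L.
  move=> k v w; rewrite /L /GRing.scale /= mulr_sumr -big_split /=.
  by apply: eq_bigr => a _; rewrite !mxE mulrDl mulrA.
pose LM := GRing.isLinear.Build _ _ _ _ _ Llin.
pose LL : {linear 'rV[R]_n -> R} := HB.pack L LM.
have cL : continuous LL.
  suff H0 : C_on 0 setT L by move=> v; exact: H0.
  apply: C_on_sum => [|a]; first exact: openT.
  by apply: C_onM; [exact: openT|exact: smooth_coord|exact: C_on_cst].
exact: (@differentiable_of_linear_bound _ _ _ f u LL cL).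
Qed.

(** The mean value theorem along [y + s *: v] reduces the remainder to differences of partial
    derivatives near [x], which are small by continuity at [x]. That one [d] serves all [y] near [x]
    is what differentiation under the integral sign requires. *)
Lemma strictly_differentiable (U : set 'rV[R]_n) f x (e : R) : open U -> U x ->
  C_on 1 U f -> 0 < e ->
  exists2 d : R, 0 < d & forall y v, ball x d y -> `|v| < d ->
    `|f (y + v) - f y - \sum_a v 0 a * 'D_('e_a) f y| <= e * `|v|.
Proof.
(* The factor 2 pays for comparing two partial derivatives with their value at [x], and [n.+1] for
   the sum over [n] coordinates, staying nonzero when [n = 0]. *)
move=> oU Ux [df Df] e0; pose e' := e / (2 * n.+1%:R).
have e'0 : 0 < e' by rewrite divr_gt0// mulr_gt0.
have [d d0 H] : exists2 d : R, 0 < d & forall y, ball x d y -> U y /\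
    forall a, `|'D_('e_a) f y - 'D_('e_a) f x| <= e'.
  have : \forall y \near x, U y /\
      forall a, `|'D_('e_a) f y - 'D_('e_a) f x| <= e'.
    near=> y; split; first by near: y; exact: open_nbhs_nbhs.
    move=> a; rewrite distrC; move: a; near: y; apply: filter_forall => a.
    by have /cvgrPdist_le /(_ _ e'0) := Df 'e_a x Ux.
  by move=> /nbhs_ballP[d /= d0 H]; exists d.
(* Half the radius for [y] and half for [v] keep the whole segment in the ball of radius [d]. *)
exists (d / 2); first by rewrite divr_gt0.
move=> y v xy vd.
have line (s : R) : 0 <= s <= 1 -> ball x d (y + s *: v).
  move=> /andP[s0 s1]; rewrite [d]splitr.
  apply: ball_triangle xy _; rewrite -ball_normE /= opprD addNKr normrN normrZ.
  by rewrite ger0_norm//; apply: le_lt_trans vd; rewrite ler_piMl.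
pose L := \sum_a v 0 a * 'D_('e_a) f y.
pose g (s : R) := f (y + s *: v) - s * L.
have dg (s : R) : 0 <= s <= 1 -> is_derive s 1 g ('D_v f (y + s *: v) - L).
  move=> s01; have [Us _] := H _ (line _ s01).
  have := is_derive_line (df _ Us) => fl.
  have dL : is_derive s 1 (L *: (id : R -> R)) (L *: (1 : R)) by apply: is_deriveZ.
  have -> : g = (fun t => f (y + t *: v)) - L *: (id : R -> R).
    by apply/funext => t; rewrite !fctE /g mulrC.
  by have := is_deriveB fl dL; rewrite [L *: 1]mulr1.
have [|||s s01 gE] := @MVT_segment R g (fun s => 'D_v f (y + s *: v) - L) 0 1.
- exact: ler01.
- by move=> s; rewrite in_itv /= => /andP[/ltW s0 /ltW s1]; apply: dg; rewrite s0.
- apply: continuous01_within => s s01.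
  by apply/differentiable_continuous/derivable1_diffP; case: (dg s s01).
move: s01; rewrite in_itv /= => s01.
move: gE; rewrite /g scale1r scale0r addr0 mul1r mul0r !subr0 mulr1.
rewrite -/L addrAC => ->.
have [Us Ds] := H _ (line _ s01).
have xdy : ball x d y by apply: le_ball xy; rewrite ler_pdivrMr// ler_pMr// ler1n.
have [Uy Dy] := H _ xdy.
rewrite derive_coordE; last exact: df.
rewrite /L -sumrB; under eq_bigr do rewrite -mulrBr.
apply: le_trans (@norm_sum_entries_le _ _ (2 * e') _) _.
  move=> a; rewrite -(subrK ('D_('e_a) f x) ('D_('e_a) f _)) -addrA.
  apply: le_trans (ler_normD _ _) _; rewrite mulr_natl mulr2n lerD//.
  by rewrite distrC.
rewrite ler_wpM2r//; pose N : R := n.+1%:R.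
have N0 : N != 0 by rewrite pnatr_eq0.
have -> : 2 * e' = e / N by rewrite /e' -/N; field.
by rewrite mulrCA ler_piMr ?(ltW e0)// ler_pdivrMr ?ltr0Sn// mul1r ler_nat.
Unshelve. all: by end_near. Qed.

End strict_differentiability.

(** * Radial means and Hadamard's coefficients *)

Section hadamard.
Context {R : realType} {n : nat}.
Variables (p : 'rV[R]_n) (r : R).
Local Notation U := (ball p r).
Implicit Types (f : 'rV[R]_n -> R) (w : R -> R) (q u v : 'rV[R]_n).

(** With constant weight 1 and a partial derivative in place of [f] this is Hadamard's coefficient.
    Differentiation in [u] multiplies the weight by [t], so general weights make the family
    stable. *)
Definition radial_mean w f q u : R :=
  integral01 (fun t => w t * f (q + t *: (u - q))).

Lemma radial_continuous w f q u : continuous01 w -> C_on 0 U f -> U q -> U u ->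
  continuous01 (fun t => w t * f (q + t *: (u - q))).
Proof.
move=> cw cf Uq Uu; apply: continuous01M => // t t01.
apply: (@continuous_comp _ _ _ (fun s : R => q + s *: (u - q)) f).
  exact: line_continuous.
by apply: cf; exact: ball_segment.
Qed.

Definition weight w := continuous01 w /\ forall t, 0 <= t <= 1 -> 0 <= w t <= 1.

Lemma weightM w : weight w -> weight (fun t => t * w t).
Proof.
move=> [cw w01]; split; first by apply: continuous01M => // t _; exact: cvg_id.
move=> t /[dup] /w01 /andP[w0 w1] /andP[t0 t1].
by rewrite mulr_ge0//= mulr_ile1.
Qed.

Lemma weight1 : weight (fun=> 1).
Proof. by split=> [|t _]; [exact: continuous01_cst|rewrite ler01 lexx]. Qed.

(** Differentiation under the integral sign: the first-order remainder of the integrand is at most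
    [e] times the norm of [v] for all parameters at once, and a weight bounded by 1 preserves this
    bound. *)
Lemma derive_radial_mean w f q u : weight w -> C_on 1 U f -> U q -> U u ->
  differentiable (radial_mean w f q) u /\
  forall v, 'D_v (radial_mean w f q) u =
    \sum_a v 0 a * radial_mean (fun t => t * w t) ('D_('e_a) f) q u.
Proof.
move=> [cw w01] f1 Uq Uu; have f0 := C_onW f1; have [df Df] := f1.
have oU : open U by exact: ball_open.
apply: differentiable_of_bound => e e0.
pose g t := q + t *: (u - q).
have gE t v : q + t *: (v + u - q) = g t + t *: v.
  by rewrite /g -addrA scalerDr addrCA addrC.
(* Moving the end point [u] by [v] moves the point at parameter [t] by [t *: v]; this is the factor
   [t] that enters the weight. *)
pose P v t := 0 <= t <= 1 ->
  `|f (g t + t *: v) - f (g t) - \sum_a (t *: v) 0 a * 'D_('e_a) f (g t)| <= e * `|v|.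
(* Near each parameter [strictly_differentiable] provides one radius for [v] valid at all
   neighbouring parameters; compactness of the segment makes it uniform. *)
have HP : \forall v \near (0 : 'rV[R]_n), `[0, 1]%classic `<=` P v.
  apply: ((compact_near_coveringP _).1 (@segment_compact R 0 1) _
    (nbhs (0 : 'rV[R]_n)) P (nbhs_filter _)) => t0 t01.
  have {}t01 : 0 <= t0 <= 1 by rewrite /= in_itv in t01.
  have Ut0 : U (g t0) by exact: ball_segment.
  have [d d0 H] := strictly_differentiable oU Ut0 f1 e0.
  have vd0 : \forall v \near (0 : 'rV[R]_n), `|v| < d.
    exact: pseudometric_normed_Zmodule.nbhs0_lt.
  exists ([set t | ball (g t0) d (g t)], [set v : 'rV[R]_n | `|v| < d]); first split.
  - by apply: line_continuous; exact: nbhsx_ballx.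
  - exact: vd0.
  - move=> [t v] /= [xt vd] /andP[t0' t1].
    have tv : `|t *: v| <= `|v| by rewrite normrZ ger0_norm// ler_piMl.
    apply: le_trans (H _ _ xt (le_lt_trans tv vd)) _.
    by rewrite ler_wpM2l// ltW.
have HU : \forall v \near (0 : 'rV[R]_n), U (v + u).
  have : \forall y \near u, U y by exact: open_nbhs_nbhs.
  by rewrite (near_shift 0) /= subr0.
near=> v.
have Uvu : U (v + u) by near: v.
pose k t := w t * (f (g t + t *: v) - f (g t) - \sum_a (t *: v) 0 a * 'D_('e_a) f (g t)).
have c1 : continuous01 (fun t => w t * f (g t + t *: v)).
  by have := radial_continuous cw f0 Uq Uvu; under eq_fun do rewrite gE.
have c2 : continuous01 (fun t => w t * f (g t)) := radial_continuous cw f0 Uq Uu.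
have c3 a : continuous01 (fun t => t * w t * 'D_('e_a) f (g t)).
  exact: (radial_continuous (weightM (conj cw w01)).1 (Df _) Uq Uu).
have [c4 I4] :=
  integral01_sum (fun a => continuous01M (@continuous01_cst _ (v 0 a)) (c3 a)).
have Ek : k = (fun t => w t * f (g t + t *: v) + (-1) * (w t * f (g t))
    + (-1) * \sum_a v 0 a * (t * w t * 'D_('e_a) f (g t))).
  apply/funext => t; rewrite /k !mulrBr !mulN1r; congr (_ - _).
  by rewrite mulr_sumr; apply: eq_bigr => a _; rewrite mxE; ring.
have c2' := continuous01M (@continuous01_cst _ (-1)) c2.
have c4' := continuous01M (@continuous01_cst _ (-1)) c4.
have E : radial_mean w f q (v + u) - radial_mean w f q u -
  \sum_a v 0 a * radial_mean (fun t => t * w t) ('D_('e_a) f) q u = integral01 k.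
  rewrite Ek integral01D//; last exact: continuous01D.
  rewrite integral01D// !integral01Z// !mulN1r I4; congr (_ - _ - _).
    by congr integral01; apply/funext => t; rewrite gE.
  by apply: eq_bigr => a _; rewrite integral01Z.
rewrite E; apply: normr_integral01_le.
  by rewrite Ek; apply: continuous01D => //; exact: continuous01D.
move=> t t01; rewrite /k normrM; have /andP[w0 w1] := w01 _ t01.
rewrite (ger0_norm w0) -[leRHS]mul1r ler_pM//.
have := near HP v; apply => //.
Unshelve. all: by end_near. Qed.

Lemma smooth_radial_mean w f q : weight w -> U q -> smooth_on U f ->
  smooth_on U (radial_mean w f q).
Proof.
move=> ww Uq sf k; have oU : open U by exact: ball_open.
elim: k w f ww sf => [|k IH] w f ww sf.
  move=> u Uu; apply: differentiable_continuous.
  by have [] := derive_radial_mean ww (sf 1%N) Uq Uu.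
apply: (@C_onS _ _ R _ _ _ (fun v u => \sum_a (cst (v 0 a) *
   radial_mean (fun t => t * w t) ('D_('e_a) f) q) u)) => //.
- by move=> u Uu; have [] := derive_radial_mean ww (sf 1%N) Uq Uu.
- by move=> u v Uu; have [_ ->] := derive_radial_mean ww (sf 1%N) Uq Uu.
- move=> v; apply: C_on_sum => // a; apply: C_onM => //; first exact: C_on_cst.
  by apply: IH; [exact: weightM|exact: smooth_derive].
Qed.

(** Integrate the derivative of [f] along the segment from [q] to [u]. At [u = q] the integrand is
    constant, which gives the value of the coefficients there. *)
Lemma hadamard_lemma f q : U q -> smooth_on U f ->
  exists h : 'I_n -> 'rV[R]_n -> R, [/\ forall a, smooth_on U (h a),
    forall a, h a q = 'D_('e_a) f q &
    forall u, U u -> f u = f q + \sum_a (u 0 a - q 0 a) * h a u].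
Proof.
move=> Uq sf; exists (fun a => radial_mean (fun=> 1) ('D_('e_a) f) q); split.
- by move=> a; apply: smooth_radial_mean => //; [exact: weight1|exact: smooth_derive].
- move=> a; rewrite /radial_mean.
  by under eq_fun do rewrite subrr scaler0 addr0 mul1r; rewrite integral01_cst.
- move=> u Uu; pose F t := f (q + t *: (u - q)).
  have cD a : continuous01 (fun t => 1 * 'D_('e_a) f (q + t *: (u - q))).
    exact: (@radial_continuous (fun=> 1) _ q u (@continuous01_cst _ 1)
      (smooth_derive _ sf 0%N) Uq Uu).
  have [c I] :=
    integral01_sum (fun a => continuous01M (@continuous01_cst _ (u 0 a - q 0 a)) (cD a)).
  rewrite (eq_bigr (fun a => integral01 (fun t => (u 0 a - q 0 a) *
    (1 * 'D_('e_a) f (q + t *: (u - q)))))); last by move=> a _; rewrite integral01Z.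
  have dF (t : R) : 0 <= t <= 1 -> is_derive t 1 F
      (\sum_a (u 0 a - q 0 a) * (1 * 'D_('e_a) f (q + t *: (u - q)))).
    move=> t01; have [df _] := sf 1%N.
    have Ut : U (q + t *: (u - q)) by exact: ball_segment.
    have := is_derive_line (df _ Ut); rewrite derive_coordE; last exact: df.
    rewrite (eq_bigr (fun a => (u 0 a - q 0 a) * (1 * 'D_('e_a) f (q + t *: (u - q)))))//.
    by move=> a _; rewrite !mxE mul1r.
  rewrite -I (integral01_FTC c dF) /F scale1r scale0r addr0.
  by rewrite [q + (u - q)]addrC subrK addrC subrK.
Qed.

End hadamard.

(** * Bump functions *)

Section flat_function.
Context {R : realType}.
Implicit Types (s : R) (m : nat).

(* The family [s^-m exp(-1/s)], extended by [0] to [s <= 0], is closed under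
   differentiation up to linear combinations. *)
Definition flat m s : R := if 0 < s then s ^- m * expR (- s^-1) else 0.

Lemma flat_gt0 m s : 0 < s -> 0 < flat m s.
Proof. by move=> s0; rewrite /flat s0 mulr_gt0 ?expR_gt0// invr_gt0 exprn_gt0. Qed.

Lemma flat_le0 m s : s <= 0 -> flat m s = 0.
Proof. by move=> s0; rewrite /flat ltNge s0. Qed.

Lemma flatS m s : s != 0 -> flat m.+1 s = s^-1 * flat m s.
Proof.
move=> s0; rewrite /flat; case: ifPn => _; last by rewrite mulr0.
by rewrite mulrA exprS invfM.
Qed.

(** One term of the exponential series, [exp(1/s) >= s^-(m+1) / (m+1)!], beats the pole. A bound
    linear in [s] makes the difference quotient at 0, which is the next member of the family, tend
    to 0. *)
Lemma flat_le m s : `|flat m s| <= m.+1`!%:R * `|s|.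
Proof.
have [s0|s0] := leP s 0; first by rewrite flat_le0// normr0 mulr_ge0.
rewrite (gtr0_norm s0) gtr0_norm ?flat_gt0// /flat s0 expRN.
have f0 : 0 < m.+1`!%:R :> R by rewrite ltr0n fact_gt0.
have H : s ^- m.+1 / m.+1`!%:R <= expR s^-1.
  apply: le_trans (expR_ge1Dxn m _); last by rewrite invr_ge0 ltW.
  by rewrite exprVn lerDr.
rewrite mulrC ler_pdivrMr ?exprn_gt0//.
have {}H : (expR s^-1)^-1 <= (s ^- m.+1 / m.+1`!%:R)^-1.
  by rewrite lef_pV2 ?posrE ?expR_gt0// divr_gt0// invr_gt0 exprn_gt0.
apply: le_trans H _; rewrite invfM !invrK mulrC -mulrA ler_pM2l//.
by rewrite exprS.
Qed.

Lemma is_derive_flat m s :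
  is_derive s 1 (flat m) (flat m.+2 s - m%:R * flat m.+1 s).
Proof.
have [s0|s0|->] := ltgtP s 0.
- rewrite !flat_le0 ?ltW// mulr0 subr0.
  have E : {near s, cst 0 =1 flat m}.
    have := lt_nbhsl s0; apply: filterS => x x0; by rewrite flat_le0// ltW.
  apply: near_eq_is_derive E _; exact: is_derive_cst.
- have E : {near s, (fun x => (x^-1) ^+ m * expR (- x^-1)) =1 flat m}.
    by have := lt_nbhsr s0; apply: filterS => x x0; rewrite /flat x0 exprVn.
  apply: (near_eq_is_derive E) => {E}.
  have s1 : s != 0 by rewrite gt_eqF.
  have dV : is_derive s 1 (fun x : R => x^-1) (- s ^- 2 *: (1 : R)).
    by apply: (@is_deriveV _ id).
  have dE := is_derive1_comp (is_derive_expR _) (is_deriveN dV).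
  have dM := is_deriveM (is_deriveX m dV) dE.
  rewrite (_ : (fun x => _) =
      (fun x : R => x^-1) ^+ m * (expR \o (- (fun x : R => x^-1)))); last first.
    by apply/funext => x; rewrite fctE exprfctE.
  apply: (is_derive_eq dM).
  rewrite /flat s0 /GRing.scale /= mulr1; case: m {dM} => [|m].
    by rewrite !mul0r mulr0 subr0 addr0 expr0 !mul1r opprK mulrC.
  rewrite exprVn /= exprfctE !exprS !invfM -!exprVn !opprK.
  rewrite -[(- _) s]/(- s^-1).
  ring.
- rewrite !flat_le0// mulr0 subr0.
  (* Only the origin remains: the difference quotient of [flat m] is [flat m.+1], controlled by
     [flat_le]. *)
  have H : h^-1 *: (flat m (h *: (1 : R) + 0) - flat m 0) @[h --> (0 : R)^'] --> (0 : R).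
    apply/cvgrPdist_le => e e0.
    near=> h; have h0 : h != 0 by near: h; exact: nbhs_dnbhs_neq.
    rewrite [flat m 0]flat_le0// subr0 addr0 [h *: 1]mulr1 [_ *: _]mulrC mulrC -flatS//.
    rewrite sub0r normrN; apply: le_trans (flat_le _ _) _.
    have f0 : 0 < m.+2`!%:R :> R by rewrite ltr0n fact_gt0.
    rewrite mulrC -ler_pdivlMr//; near: h; apply: dnbhs0_le; exact: divr_gt0.
  by split; [exact: cvgP H|exact: cvg_lim H].
Unshelve. all: by end_near. Qed.

(** Differentiation raises the index of [flat], so the induction on the order treats all [m] at
    once. *)
Lemma smooth_flat_comp n (U : set 'rV[R]_n) m (l : 'rV[R]_n -> R) : open U ->
  smooth_on U l -> smooth_on U (flat m \o l).
Proof.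
move=> oU sl k; have [dl _] := sl 1%N.
have df i (x : R) : differentiable (flat i) x.
  by apply/derivable1_diffP; case: (is_derive_flat i x).
elim: k m => [|k IH] m.
  move=> x Ux; apply: continuous_comp; first exact: (sl 0%N).
  exact/differentiable_continuous/df.
apply: (@C_onS _ _ R _ _ _ (fun v => 'D_v l *
  (flat m.+2 \o l + cst (- m%:R) * (flat m.+1 \o l)))) => //.
- by move=> x Ux; apply: differentiable_comp => //; exact: dl.
- move=> x v Ux; have dlx := dl _ Ux.
  rewrite deriveE; last by apply: differentiable_comp.
  have E w : 'd (flat m) (l x) w = w * (flat m.+2 (l x) - m%:R * flat m.+1 (l x)).
    rewrite -{1}[w]mulr1 -[w * 1]/(w *: (1 : R)) linearZ /= -deriveE//.
    by rewrite (@derive_val _ _ _ _ _ _ _ (is_derive_flat _ _)).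
  by rewrite diff_comp//= E -deriveE// !fctE /= mulNr.
- move=> v; apply: C_onM => //; first exact: (smooth_derive v sl).
  apply: C_onD => //; apply: C_onM => //; exact: C_on_cst.
Qed.

End flat_function.

Section cube_bump.
Context {R : realType} {n : nat}.
Implicit Types (p u : 'rV[R]_n) (r : R).

(** Balls of row vectors are cubes for the maximum norm, so a product of one-variable bumps is
    nonzero exactly on the ball. *)
Definition cube_bump p r u : R := \prod_a flat 0 (r ^+ 2 - (u 0 a - p 0 a) ^+ 2).

Lemma smooth_cube_bump p r : smooth_on setT (cube_bump p r).
Proof.
apply: smooth_prod => [|a]; first exact: openT.
apply: (@smooth_flat_comp _ _ _ 0 (fun u => r ^+ 2 - (u 0 a - p 0 a) ^+ 2)).
  exact: openT.
have sc (b : R) : smooth_on setT (fun _ : 'rV[R]_n => b).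
  by move=> k; exact: (C_on_cst k setT b).
have su : smooth_on setT (fun u : 'rV[R]_n => u 0 a - p 0 a).
  by apply: smoothB => //; [exact: openT|exact: smooth_coord].
apply: smoothB; [exact: openT|exact: sc|].
under eq_fun do rewrite expr2.
by apply: smoothM => //; exact: openT.
Qed.

Lemma cube_bump_neq0 p r u : 0 < r -> (cube_bump p r u != 0) = `[< ball p r u >].
Proof.
move=> r0; have E a : (0 < r ^+ 2 - (u 0 a - p 0 a) ^+ 2) = (`|p 0 a - u 0 a| < r).
  by rewrite subr_gt0 -real_normK ?num_real// ltr_pXn2r ?nnegrE// ?(ltW r0)// distrC.
apply/idP/idP => [b0|/asboolP [_ pu]].
  apply/asboolP; split=> // i a; rewrite ord1 /ball /=.
  rewrite -E ltNge; apply: contra b0 => le0.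
  by rewrite /cube_bump (bigD1 a)//= flat_le0// mul0r.
apply/prodf_neq0 => a _; rewrite gt_eqF// flat_gt0// E; exact: pu.
Qed.

End cube_bump.

(** * Local frames of vector fields *)

Section local_smoothness.
Context {R : realType} {n : nat} (M : smooth_manifold R n).
Implicit Types (F : M -> R) (f : smooth_fun M).

Lemma smooth_funP f i : smooth_on (chart i @` chart_dom i) (f \o chart_inv i).
Proof. by case: f => f /= /asboolP; exact. Qed.

Lemma chart_inv_dom (i : chart_index M) u : (chart i @` chart_dom i) u ->
  chart_dom i (chart_inv i u) /\ chart i (chart_inv i u) = u.
Proof. by move=> [m mi <-]; rewrite chartK. Qed.

Lemma chart_img_openI (i : chart_index M) (B : set M) : open B ->
  open (chart i @` (chart_dom i `&` B)).
Proof.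
move=> oB; rewrite openE => u [m [mi mB] <-].
have imi : (chart i @` chart_dom i) (chart i m) by exists m.
have : \forall v \near chart i m, B (chart_inv i v).
  by apply: (chart_inv_continuous imi); rewrite chartK//; exact: open_nbhs_nbhs.
have := open_nbhs_nbhs (conj (@chart_img_open _ _ M i) imi); apply: filterS2 => v vi vB.
have [di ci] := chart_inv_dom vi.
by exists (chart_inv i v).
Qed.

Lemma is_smooth_local F :
  (forall m, exists B, [/\ open B, B m &
     forall j, smooth_on (chart j @` (chart_dom j `&` B)) (F \o chart_inv j)]) ->
  F \in is_smooth (M:=M).
Proof.
move=> H; apply/asboolP => j k; apply: C_on_local => _ [m mj <-].
have [B [oB Bm sB]] := H m.
by exists (chart j @` (chart_dom j `&` B)); split; [exists m|exact: sB].
Qed.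

Lemma smooth_fun_continuous f : continuous f.
Proof.
move=> m; have [i mi] := chart_cover m.
have imi : (chart i @` chart_dom i) (chart i m) by exists m.
have cf : {for m, continuous ((f \o chart_inv i) \o chart i)}.
  by apply: continuous_comp; [exact: chart_continuous|exact: (smooth_funP f i 0%N _ imi)].
rewrite /prop_for /continuous_at /= chartK// in cf.
apply: cvg_trans cf; apply: near_eq_cvg.
have : \forall x \near m, chart_dom i x.
  by apply: open_nbhs_nbhs; split => //; exact: chart_dom_open.
by apply: filterS => x xi /=; rewrite chartK.
Qed.

(** The nonvanishing set of [b] is open by continuity, and there [F] is a quotient of smooth
    functions. Fields glued from local solutions are recognized as smooth in this form. *)
Lemma is_smooth_frac F :
  (forall m, exists a b : smooth_fun M, b m != 0 /\
     forall m', b m' != 0 -> F m' = a m' / b m') ->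
  F \in is_smooth (M:=M).
Proof.
move=> H; apply: is_smooth_local => m; have [a [b [bm Fab]]] := H m.
have oB : open [set m' | b m' != 0].
  have := @open_comp _ _ b [set x | x != 0] (fun x _ => @smooth_fun_continuous b x).
  apply; have -> : [set x : R | x != 0] = ~` [set 0].
    by apply/seteqP; split => x /= /eqP.
  exact/closed_openC/closed_eq.
exists [set m' | b m' != 0]; split => // j k.
have oV := chart_img_openI (i:=j) oB.
have sub : chart j @` (chart_dom j `&` [set m' | b m' != 0]) `<=`
    chart j @` chart_dom j by apply: image_subset => x [].
apply: (@eq_C_on _ _ _ _ _ (fun u => (a \o chart_inv j) u * ((b \o chart_inv j) u)^-1)).
- exact: oV.
- by move=> _ [x [xj bx] <-]; rewrite /= chartK// Fab.
- apply: smoothM => //; first by move=> l; apply: C_on_sub sub _; exact: smooth_funP.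
  apply: smoothV => //; first by move=> _ [x [xj bx] <-]; rewrite /= chartK.
  by move=> l; apply: C_on_sub sub _; exact: smooth_funP.
Qed.

End local_smoothness.

Section evaluation.
Context {R : realType} {n : nat} (M : smooth_manifold R n).
Implicit Types (f h : smooth_fun M) (m : M).

Lemma smooth_fun_eq f h : (forall m, f m = h m) -> f = h.
Proof. by move=> fh; apply/val_inj/funext. Qed.

Lemma smooth_addE f h m : (f + h) m = f m + h m. Proof. by []. Qed.
Lemma smooth_mulE f h m : (f * h) m = f m * h m. Proof. by []. Qed.
Lemma smooth_oppE f m : (- f) m = - f m. Proof. by []. Qed.
Lemma smooth_sumE (I : finType) (F : I -> smooth_fun M) m :
  (\sum_i F i) m = \sum_i F i m.
Proof. by apply: (big_morph (fun f : smooth_fun M => f m)). Qed.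

(** A named evaluation can carry a ring morphism structure, through which determinants over the
    smooth functions are evaluated entrywise. *)
Definition eval_at m f : R := f m.

Fact eval_at_is_zmod_morphism m : zmod_morphism (eval_at m). Proof. by []. Qed.
Fact eval_at_is_monoid_morphism m : monoid_morphism (eval_at m). Proof. by []. Qed.

HB.instance Definition _ m :=
  GRing.isZmodMorphism.Build _ _ (eval_at m) (eval_at_is_zmod_morphism m).
HB.instance Definition _ m :=
  GRing.isMonoidMorphism.Build _ _ (eval_at m) (eval_at_is_monoid_morphism m).

Lemma vector_field_eq (x y : vector_field M) :
  (forall f m, x f m = y f m) -> x = y.
Proof. by move=> xy; apply/val_inj/funext => f; exact/smooth_fun_eq/xy. Qed.

Lemma vector_field_scaleE h (x : vector_field M) f m : (h *: x) f m = h m * x f m.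
Proof. by []. Qed.
Lemma vector_field_sumE (I : finType) (x : I -> vector_field M) f m :
  (\sum_i x i) f m = \sum_i x i f m.
Proof. by apply: (big_morph (fun x : vector_field M => x f m)). Qed.

Lemma derivation_constant (x : vector_field M) a : x (constant_fun M a) = 0.
Proof.
have one : constant_fun M a = constant_fun M a * 1 by rewrite mulr1.
have x1 : x 1 = 0.
  by have := derivationM x 1 1; rewrite !mulr1 mul1r => /esym/eqP;
    rewrite -subr_eq0 addrK => /eqP.
by rewrite one derivationZ x1 mulr0.
Qed.

Lemma derivationN (x : vector_field M) f : x (- f) = - x f.
Proof.
have nE h : - h = constant_fun M (-1) * h.
  by apply: smooth_fun_eq => m; rewrite smooth_mulE smooth_oppE /= mulN1r.
by rewrite nE derivationZ -nE.
Qed.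

End evaluation.

Section coordinate_frame.
Context {R : realType} {n : nat} (M : smooth_manifold R n).
Variables (i : chart_index M) (m0 : M) (r : R).
Hypothesis m0i : chart_dom i m0.
Hypothesis r0 : 0 < r.
Local Notation p := (chart i m0).
Local Notation U := (ball p r).
Hypothesis Ui : U `<=` chart i @` chart_dom i.
Local Notation bmp := (cube_bump p (r / 2)).
Implicit Types (w : 'rV[R]_n -> R) (f : smooth_fun M) (y : vector_field M).

Definition patch : set M := [set m | chart_dom i m /\ U (chart i m)].

(** The bump has half the radius of [U], so the extension by zero is smooth however [w] behaves near
    the boundary of [U]. *)
Definition cutoff_fun w (m : M) : R :=
  if `[< patch m >] then bmp (chart i m) * w (chart i m) else 0.

Let r2_gt0 : 0 < r / 2. Proof. exact: divr_gt0. Qed.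

Let closed_half_ball_sub : closed_ball p (r / 2) `<=` U.
Proof.
move=> u; rewrite closed_ballE// -ball_normE /closed_ball_ /= => /le_lt_trans; apply.
by rewrite ltr_pdivrMr// ltr_pMr// ltr1n.
Qed.

Let core : set M := chart_inv i @` closed_ball p (r / 2).

(** A closed ball of row vectors is compact, hence so is its image under [chart_inv], and compact
    sets are closed because the manifold is Hausdorff. *)
Let closed_core : closed core.
Proof.
apply: compact_closed; first exact: carrier_hausdorff.
apply: continuous_compact; last first.
  apply: bounded_closed_compact; last exact: closed_ball_closed.
  exists (`|p| + r / 2); split; first exact: num_real.
  move=> x xr u; rewrite closed_ballE// /closed_ball_ /= => pu.
  apply: le_trans (ltW xr); rewrite -[u](subrK p) addrC.
  by rewrite (le_trans (ler_normD _ _))// lerD2l distrC.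
apply: continuous_in_subspaceT => u; rewrite inE => /closed_half_ball_sub /Ui.
exact: chart_inv_continuous.
Qed.

Let open_patch : open patch.
Proof.
rewrite openE => m [mi Um].
have H1 : \forall x \near m, chart_dom i x.
  by apply: open_nbhs_nbhs; split => //; exact: chart_dom_open.
have H2 : \forall x \near m, U (chart i x).
  by apply: (chart_continuous mi); apply: open_nbhs_nbhs; split => //; exact: ball_open.
by move: H1 H2; apply: filterS2.
Qed.

(** [patch] and the complement of [core] are open and cover the manifold. On the first the function
    is a product read through the transition maps; on the second it is zero. *)
Lemma cutoff_fun_smooth w : smooth_on U w -> cutoff_fun w \in is_smooth (M:=M).
Proof.
move=> sw; apply: is_smooth_local => m.
have [[u pu um]|mK] := pselect (core m).
  have im := Ui (closed_half_ball_sub pu).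
  have [di ci] := chart_inv_dom im.
  exists patch; split => //.
    by rewrite -um; split => //; rewrite ci; exact: closed_half_ball_sub.
  move=> j; have oV := chart_img_openI (i:=j) open_patch.
  move=> k; apply: (@eq_C_on _ _ _ _ _
    ((fun u => bmp u * w u) \o (chart i \o chart_inv j))).
  - exact: oV.
  - move=> _ [x [xj px] <-]; rewrite /= /cutoff_fun chartK//.
    by case: asboolP.
  - apply: (@smooth_comp _ _ _ _ U).
    + exact: oV.
    + by move=> _ [x [xj [xi Ux]] <-]; rewrite /= chartK.
    + move=> l; apply: C_on_sub (chart_transition j i l).
      by apply: image_subset => x [xj [xi _]].
    + apply: smoothM => //; first exact: ball_open.
      by move=> l; apply: C_on_sub (smooth_cube_bump p (r / 2) l).
exists (~` core); split => //; first exact/closed_openC/closed_core.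
move=> j k; apply: (@eq_C_on _ _ _ _ _ (cst 0)).
- by apply: chart_img_openI; exact/closed_openC/closed_core.
- move=> _ [x [xj xK] <-]; rewrite /= /cutoff_fun chartK//.
  case: asboolP => // -[xi Ux].
  have [->|] := eqVneq (bmp (chart i x)) 0; first by rewrite mul0r.
  rewrite cube_bump_neq0// => /asboolP Bx; exfalso; apply: xK.
  by exists (chart i x); [exact: subset_closed_ball|rewrite chartK].
- exact: C_on_cst.
Qed.

Definition cutoff w (sw : smooth_on U w) : smooth_fun M :=
  SmoothFun (cutoff_fun_smooth sw).

Lemma cutoffE w (sw : smooth_on U w) m : patch m ->
  cutoff sw m = bmp (chart i m) * w (chart i m).
Proof. by move=> pm; rewrite /= /cutoff_fun asboolT. Qed.

Lemma cutoff_out w (sw : smooth_on U w) m : ~ patch m -> cutoff sw m = 0.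
Proof. by move=> pm; rewrite /= /cutoff_fun asboolF. Qed.

Lemma smooth_local_repr f : smooth_on U (f \o chart_inv i).
Proof. by move=> k; apply: C_on_sub Ui _; exact: smooth_funP. Qed.

(** This operator is the coordinate field of index [a] multiplied by the bump, which makes it
    global. *)
Fact frame_field_is_derivation a :
  (fun f => cutoff (smooth_derive 'e_a (smooth_local_repr f)))
    \in is_derivation (M:=M).
Proof.
apply/asboolP; split=> [c f h|f h]; apply: smooth_fun_eq => m;
  rewrite ?smooth_addE ?smooth_mulE;
  have [df _] := smooth_local_repr f 1%N; have [dh _] := smooth_local_repr h 1%N;
  (have [pm|pm] := pselect (patch m); last
    by rewrite ?cutoff_out// ?mulr0 ?mul0r ?addr0).
- rewrite !cutoffE//; case: pm => mi Um.
  have -> : (constant_fun M c * f + h) \o chart_inv i =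
     c *: (f \o chart_inv i) + (h \o chart_inv i) by [].
  rewrite deriveD ?deriveZ; last 3 first.
  + exact/diff_derivable/df.
  + exact/derivableZ/diff_derivable/df.
  + exact/diff_derivable/dh.
  by rewrite mulrDr /GRing.scale /= mulrCA.
- rewrite !cutoffE//; case: pm => mi Um.
  have -> : (f * h) \o chart_inv i = (f \o chart_inv i) * (h \o chart_inv i) by [].
  rewrite deriveM; last 2 first.
  + exact/diff_derivable/df.
  + exact/diff_derivable/dh.
  rewrite /GRing.scale /= chartK//.
  ring.
Qed.

Definition frame_field a : vector_field M := VectorField (frame_field_is_derivation a).

Lemma frame_fieldE a f m : patch m ->
  frame_field a f m = bmp (chart i m) * 'D_('e_a) (f \o chart_inv i) (chart i m).
Proof. exact: cutoffE. Qed.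

Definition cutoff1 : smooth_fun M := cutoff (fun k => C_on_cst k U 1).
Definition cutoff_coord a : smooth_fun M := cutoff (@smooth_coord R n U a).

(** By the Leibniz rule this is [cutoff1 ^+ 2] times the derivative along [y] of the coordinate of
    index [a], written without applying [y] to a function defined only locally. *)
Definition frame_coef y a : smooth_fun M :=
  cutoff1 * y (cutoff_coord a) - cutoff_coord a * y cutoff1.

Lemma cutoff1_neq0 : cutoff1 m0 != 0.
Proof.
have pm0 : patch m0 by split => //; exact: ballxx.
by rewrite cutoffE// mulr1 cube_bump_neq0//; apply/asboolP; exact: ballxx.
Qed.

(** The bumped coordinate vanishes at [m0] after subtracting its value, so only the derivative of
    the coordinate contributes. This yields linear independence of the frame at [m0]. *)
Lemma frame_field_dual a b :
  frame_field a (cutoff_coord b - constant_fun M (p 0 b) * cutoff1) m0 =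
  cutoff1 m0 ^+ 2 * (b == a)%:R.
Proof.
have Up : U p := ballxx _ r0.
have pm0 : patch m0 by split.
rewrite frame_fieldE// (@near_eq_derive _ _ _ _
  (cube_bump p (r / 2) * (fun u => u 0 b - p 0 b))).
  have [db _] := smooth_cube_bump p (r / 2) 1%N.
  have du : differentiable (fun u : 'rV[R]_n => u 0 b) p := differentiable_coord _ _ _.
  rewrite deriveM; [|exact/diff_derivable/db|]; last first.
    by apply: derivableB; [exact: diff_derivable|exact: derivable_cst].
  rewrite deriveB; [|exact: diff_derivable|exact: derivable_cst].
  rewrite derive_cst derive_coord subrr scale0r addr0 subr0 mxE eqxx andTb.
  by rewrite /cutoff1 cutoffE// mulr1 expr2 -mulrA.
have : \forall u \near p, U u by apply: open_nbhs_nbhs; split => //; exact: ball_open.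
apply: filterS => u Uu; have [di ci] := chart_inv_dom (Ui Uu).
rewrite -[LHS]/((cutoff_coord b - constant_fun M (p 0 b) * cutoff1) (chart_inv i u)).
rewrite smooth_addE smooth_oppE smooth_mulE /cutoff1 /cutoff_coord.
rewrite !cutoffE ?ci//; try by split; rewrite ?ci.
rewrite mulr1 fctE [constant_fun M _ _]/=.
ring.
Qed.

(* Hadamard's lemma expresses [y] through its values on the coordinates; the
   power of [cutoff1] makes coordinates and coefficients globally defined. *)
Lemma frame_expansion y :
  cutoff1 ^+ 3 *: y = \sum_a frame_coef y a *: frame_field a.
Proof.
apply: vector_field_eq => f m; rewrite vector_field_sumE vector_field_scaleE.
have [pm|pm] := pselect (patch m); last first.
  rewrite exprS smooth_mulE cutoff_out// !mul0r big1// => a _.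
  rewrite vector_field_scaleE /frame_coef smooth_addE smooth_oppE !smooth_mulE.
  by rewrite !cutoff_out// !mul0r subrr mul0r.
have [mi Um] := pm; pose q := chart i m.
have [h [sh hq hE]] := hadamard_lemma Um (smooth_local_repr f).
pose H a := cutoff (sh a).
(* Hadamard's expansion at [q], with one bump for the coordinate factor and one for the coefficient,
   becomes an identity of global functions to which [y] applies. *)
have E : cutoff1 * cutoff1 * (f - constant_fun M (f m)) =
  \sum_a (cutoff_coord a - constant_fun M (q 0 a) * cutoff1) * H a.
  apply: smooth_fun_eq => m'; rewrite smooth_sumE !smooth_mulE smooth_addE smooth_oppE.
  have [pm'|pm'] := pselect (patch m'); last first.
    rewrite !cutoff_out// !mul0r big1// => a _.
    by rewrite smooth_mulE cutoff_out// mulr0.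
  have [mi' Um'] := pm'.
  have fE : f m' = f m + \sum_a (chart i m' 0 a - q 0 a) * h a (chart i m').
    by have := hE _ Um'; rewrite /= !chartK.
  rewrite /cutoff1 !cutoffE// mulr1 fE [constant_fun M _ _]/=.
  rewrite addrAC subrr add0r mulr_sumr.
  apply: eq_bigr => a _.
  rewrite /H smooth_mulE smooth_addE smooth_oppE smooth_mulE !cutoffE// mulr1.
  rewrite [constant_fun M _ _]/=.
  ring.
have yB (k l : smooth_fun M) : y (k - l) = y k - y l by rewrite derivationD derivationN.
have ysum (k : 'I_n -> smooth_fun M) : y (\sum_a k a) = \sum_a y (k a).
  have y0 : y 0 = 0 by apply: (addrI (y 0)); rewrite -derivationD !addr0.
  exact: (big_morph _ (derivationD y) y0).
(* At [m] both [f - f m] and the shifted coordinates vanish, so the Leibniz rule leaves a single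
   term on each side. *)
have {}E : cutoff1 m * cutoff1 m * y f m = \sum_a
    (y (cutoff_coord a) m - q 0 a * y cutoff1 m) *
    (cutoff1 m * 'D_('e_a) (f \o chart_inv i) q).
  transitivity (y (cutoff1 * cutoff1 * (f - constant_fun M (f m))) m).
    rewrite derivationM yB derivation_constant subr0.
    by rewrite smooth_addE !smooth_mulE smooth_addE smooth_oppE subrr mulr0 add0r.
  rewrite E ysum smooth_sumE; apply: eq_bigr => a _.
  rewrite derivationM yB derivationZ !(smooth_addE, smooth_mulE, smooth_oppE).
  rewrite /H /cutoff1 /cutoff_coord !cutoffE// mulr1 hq [constant_fun M _ _]/= -/q.
  ring.
have c3 : (cutoff1 ^+ 3) m = cutoff1 m * (cutoff1 m * cutoff1 m) by [].
rewrite c3 -mulrA E mulr_sumr; apply: eq_bigr => a _.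
rewrite vector_field_scaleE /frame_coef !(smooth_addE, smooth_mulE, smooth_oppE).
rewrite frame_fieldE// /cutoff1 /cutoff_coord !cutoffE// mulr1 -/q.
ring.
Qed.

End coordinate_frame.

(** * Musical isomorphism *)

Section sharp.
Context {R : realType} {n : nat} (M : smooth_manifold R n).
Local Notation X := (vector_field M).
Local Notation A := (smooth_fun M).

Lemma scalar_sum (f : X -> A) (I : finType) (c : I -> A) (x : I -> X) :
  scalar f -> f (\sum_a c a *: x a) = \sum_a c a * f (x a).
Proof.
move=> fl; pose fM := GRing.isLinear.Build _ _ _ _ _ fl.
pose F : {scalar X} := HB.pack f fM.
rewrite -[f]/(F : X -> A) linear_sum; apply: eq_bigr => a _.
by rewrite linearZ.
Qed.

Lemma scalarZ_prop (f : X -> A) a x : scalar f -> f (a *: x) = a * f x.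
Proof.
by move=> fl; have := scalar_sum (fun _ : 'I_1 => a) (fun=> x) fl; rewrite !big_ord1.
Qed.

Lemma scalarN_prop (f : X -> A) x : scalar f -> f (- x) = - f x.
Proof. by move=> fl; rewrite -scaleN1r scalarZ_prop// mulN1r. Qed.

Variable g : X -> X -> A.
Hypothesis gm : pseudo_riemannian_metric g.

Let gC x y : g x y = g y x. Proof. by case: gm. Qed.
Let gl x : scalar (g x). Proof. by case: gm. Qed.

Lemma metric_eq0 x : (forall y, g x y = 0) -> x = 0.
Proof.
move=> gx; apply: vector_field_eq => f m; have [_ _ nd] := gm.
by apply: (nd m) => y; rewrite gx.
Qed.

Lemma metric_eq x y : (forall z, g x z = g y z) -> x = y.
Proof.
move=> xy; apply/eqP; rewrite -subr_eq0; apply/eqP/metric_eq0 => z.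
rewrite gC -scaleN1r addrC gl gC -xy (gC x).
by rewrite mulN1r addNr.
Qed.

(** Cramer's rule for the Gram matrix of the local frame. The adjugate replaces the inverse, and the
    factor [c] collects the determinant and the bumps, which may vanish away from [m0]. *)
Lemma local_sharp (m0 : M) (alpha : X -> A) : scalar alpha ->
  exists (x : X) (c : A), c m0 != 0 /\ forall y, g x y = c * alpha y.
Proof.
move=> al; have [i m0i] := chart_cover m0.
have imi : (chart i @` chart_dom i) (chart i m0) by exists m0.
have [r /= r0 Ui] : exists2 r : R, 0 < r &
    ball (chart i m0) r `<=` chart i @` chart_dom i.
  have := open_nbhs_nbhs (conj (@chart_img_open _ _ M i) imi).
  by move=> /nbhs_ballP[r /= r0 Ui]; exists r.
pose e := frame_field r0 Ui; pose c := frame_coef r0 Ui.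
pose B := cutoff1 r0 Ui.
have expand y : B ^+ 3 *: y = \sum_a c y a *: e a := frame_expansion _ _ _.
pose G : 'M[A]_n := \matrix_(a, b) g (e a) (e b).
have B0 : B m0 != 0 := cutoff1_neq0 m0i r0 Ui.
(* A kernel vector of the Gram matrix at [m0] gives a combination of the frame orthogonal to every
   field at [m0]. It vanishes there by nondegeneracy, and [frame_field_dual] recovers its
   coefficients as zero. *)
have detG : smooth_fun_val (\det G) m0 != 0.
  rewrite -[smooth_fun_val (\det G) m0]/(eval_at m0 (\det G)) -det_map_mx.
  apply/negP => /det0P[v v0 vG]; apply: (negP v0); apply/eqP.
  pose x := \sum_a constant_fun M (v 0 a) *: e a.
  have xe b : g x (e b) m0 = 0.
    rewrite gC scalar_sum// smooth_sumE.
    have := congr1 (fun u : 'rV[R]_n => u 0 b) vG; rewrite !mxE => vGb.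
    rewrite -[RHS]vGb; apply: eq_bigr => a _; by rewrite smooth_mulE !mxE gC.
  have xy y : g x y m0 = 0.
    have := congr1 (fun h : A => h m0) (congr1 (g x) (expand y)).
    rewrite scalarZ_prop// scalar_sum// smooth_mulE smooth_sumE big1 => [/eqP|a _].
      rewrite mulf_eq0 -[smooth_fun_val (B ^+ 3) m0]/(B m0 * (B m0 * B m0)).
      by rewrite !mulf_eq0 (negPf B0) => /eqP.
    by rewrite smooth_mulE xe mulr0.
  have [_ _ nd] := gm; have {}nd f : x f m0 = 0 by exact: nd.
  apply/rowP => b; rewrite mxE.
  have := nd (cutoff_coord r0 Ui b - constant_fun M (chart i m0 0 b) * B).
  rewrite vector_field_sumE (bigD1 b)// big1 => [|a ab].
    rewrite vector_field_scaleE frame_field_dual// eqxx mulr1 => vb.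
    have {vb} : v 0 b * B m0 ^+ 2 + 0 = 0 := vb; rewrite addr0 => /eqP.
    by rewrite mulf_eq0 expf_eq0/= (negPf B0) orbF => /eqP.
  by rewrite vector_field_scaleE frame_field_dual// eq_sym (negPf ab) !mulr0.
pose u : 'rV[A]_n := (\row_a alpha (e a)) *m \adj G.
have uG : u *m G = \det G *: \row_a alpha (e a).
  by rewrite -mulmxA mul_adj_mx mul_mx_scalar.
pose x0 := \sum_a u 0 a *: e a.
have x0e b : g x0 (e b) = \det G * alpha (e b).
  rewrite gC scalar_sum//.
  have := congr1 (fun w : 'rV[A]_n => w 0 b) uG; rewrite !mxE => <-.
  by apply: eq_bigr => a _; rewrite !mxE gC.
(* The power [B ^+ 3] moves onto [y], where [frame_expansion] writes it in the frame on which [x0]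
   is known. *)
exists (B ^+ 3 *: x0), (B ^+ 3 * \det G); split.
  have c3 : smooth_fun_val (B ^+ 3) m0 = B m0 * (B m0 * B m0) by [].
  by rewrite smooth_mulE c3 !mulf_neq0.
move=> y.
rewrite gC scalarZ_prop// gC -scalarZ_prop// expand scalar_sum//.
rewrite (eq_bigr (fun a => \det G * (c y a * alpha (e a)))); last first.
  by move=> a _; rewrite x0e mulrCA.
by rewrite -mulr_sumr -scalar_sum// -expand scalarZ_prop// mulrCA mulrA.
Qed.

(* Local solutions agree up to their nonvanishing factors, so dividing the
   solution chosen at each point by its factor glues them together. *)
Theorem sharp (alpha : X -> A) : scalar alpha ->
  exists x : X, forall y, g x y = alpha y.
Proof.
move=> al.
have /choice[s sP] (m : M) : exists s : X * A,
    s.2 m != 0 /\ forall y, g s.1 y = s.2 * alpha y.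
  by have [x [c [cm xc]]] := local_sharp m al; exists (x, c).
pose x m := (s m).1; pose c m := (s m).2.
have c0 m : c m m != 0 by have [] := sP m.
have xE m y : g (x m) y = c m * alpha y by have [_ ->] := sP m.
have agree m m' : c m' *: x m = c m *: x m'.
  by apply: metric_eq => y; rewrite !(gC _ y) !scalarZ_prop// !(gC y) !xE mulrCA.
pose F f m := x m f m / c m m.
have FE m f m' : c m m' != 0 -> F f m' = x m f m' / c m m'.
  move=> cm'; apply/eqP; rewrite eqr_div ?c0//; apply/eqP.
  have := congr1 (fun v : X => v f m') (agree m m').
  by rewrite !vector_field_scaleE => e; rewrite mulrC -e mulrC.
have Fs f : F f \in is_smooth (M:=M).
  by apply: is_smooth_frac => m; exists (x m f), (c m); split => // m'; exact: FE.
pose G f := SmoothFun (Fs f).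
have Gd : G \in is_derivation (M:=M).
  apply/asboolP; split=> [a f h|f h]; apply: smooth_fun_eq => m.
    rewrite smooth_addE smooth_mulE /= /F derivation_cst smooth_addE smooth_mulE.
    by rewrite mulrDl mulrA.
  rewrite smooth_addE !smooth_mulE /= /F derivationM smooth_addE !smooth_mulE.
  by rewrite mulrDl mulrA [_ * h m / _]mulrAC.
exists (VectorField Gd) => y; apply: smooth_fun_eq => m; apply: (mulfI (c0 m)).
(* By agreement the glued field times [c m] is [x m] on the whole manifold; the equation for [x m]
   is then divided by [c m] at [m], where it is nonzero. *)
have cG : c m *: VectorField Gd = x m.
  apply: vector_field_eq => f m'; rewrite vector_field_scaleE /= /F.
  have := congr1 (fun v : X => v f m') (agree m m').
  by rewrite !vector_field_scaleE mulrA => <-; rewrite mulrC mulKf.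
have gZ : g (c m *: VectorField Gd) y = c m * g (VectorField Gd) y.
  by rewrite gC scalarZ_prop// gC.
by rewrite -!smooth_mulE -xE -cG gZ.
Qed.

End sharp.

(** * Skew-symmetric torsion of an almost contact metric structure *)

Section pointwise_identities.
Context {K : realFieldType} {V : Type}.
Variables (phi : V -> V) (xi : V) (eta : V -> K).
Variables (F : V -> V -> V -> K) (w : V -> V -> K).
Hypothesis eta_phi : forall x, eta (phi x) = 0.
Hypothesis eta_xi : eta xi = 1.
Hypothesis F_skew : forall x y z, F x z y = - F x y z.
Hypothesis F_phi : forall x y z,
  F x (phi y) z - F x y (phi z) = w x y * eta z + eta y * w x z.
Hypothesis F_xi : forall x z, F x xi z = w x (phi z).
Hypothesis F_phi_xi1 : forall y z, F (phi xi) y z = 0.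
Hypothesis F_phi_xi3 : forall x y, F x y (phi xi) = 0.
Hypothesis F_phi2 : forall x y z, F (phi (phi x)) y z = - F x y z + eta x * F xi y z.
Hypothesis F3_phi2 : forall x y z, F x y (phi (phi z)) = - F x y z + eta z * F x y xi.
Hypothesis w_xi : forall x, w x xi = 0.
Hypothesis w_phi2 : forall x y, w (phi (phi x)) y = - w x y + eta x * w xi y.
Hypothesis w2_phi2 : forall x y, w x (phi (phi y)) = - w x y.

(** Values lie in an ordered field and tensoriality enters only through the section hypotheses. The
    identities below thus become linear relations between scalar monomials, within reach of
    [lra]. *)
Definition class_form x y z : K :=
  F (phi x) y z + F (phi y) x z + F x y (phi z) + F y x (phi z).

(** The arguments [xi, xi, z] give [w xi z = 0]. The arguments [phi x, phi y, xi] then kill the last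
    two terms and leave minus the symmetric sum of [w]. *)
Lemma class_form_skew_w : (forall x y z, class_form x y z = 0) ->
  forall x y, w x y + w y x = 0.
Proof.
move=> S0.
have wxi z : w xi z = 0.
  have := S0 xi xi z; rewrite /class_form !F_phi_xi1 F_xi w2_phi2; lra.
move=> x y; have := S0 (phi x) (phi y) xi.
rewrite /class_form !F_phi_xi3 ![F _ _ xi]F_skew !F_xi !w_phi2 !wxi !w2_phi2; lra.
Qed.

Hypothesis w_skew : forall x y, w x y + w y x = 0.

Let wC x y : w y x = - w x y. Proof. have := w_skew x y; lra. Qed.

Let w_xi1 x : w xi x = 0. Proof. by rewrite wC w_xi oppr0. Qed.

(* [2 form_B] is the Nijenhuis tensor once it is known to be a 3-form. *)
Definition form_B x y z : K := F (phi x) y z + F x y (phi z) + w x y * eta z.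

Definition form_K x y z : K := F x y (phi z) + w x y * eta z.

Lemma form_B_skew23 x y z : form_B x z y = - form_B x y z.
Proof.
rewrite /form_B; have := F_phi x y z.
rewrite (F_skew (phi x) y z) (F_skew x (phi y) z); lra.
Qed.

Lemma form_K_skew23 x y z : form_K x z y = - form_K x y z.
Proof. rewrite /form_K; have := F_phi x y z; rewrite (F_skew x (phi y) z); lra. Qed.

Lemma class_formE x y z : class_form x y z = form_B x y z + form_B y x z.
Proof. rewrite /class_form /form_B (wC x y); lra. Qed.

(** The hypothesis is skew-symmetry of the Nijenhuis tensor in its last two slots. As B is skew
    there, two terms cancel and [B y x z = - B z x y] remains; two transpositions generate all
    permutations. *)
Lemma form_B_skew12P :
  (forall x y z, form_B x z y - form_B z x y = - (form_B x y z - form_B y x z)) ->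
  forall x y z, class_form x y z = 0.
Proof.
move=> H x y z; rewrite class_formE.
have := H z x y; have := form_B_skew23 z x y; have := form_B_skew23 x z y.
have := form_B_skew23 y x z; lra.
Qed.

Hypothesis class0 : forall x y z, class_form x y z = 0.

Lemma form_B_skew12 x y z : form_B y x z = - form_B x y z.
Proof. have := class0 x y z; rewrite class_formE; lra. Qed.

(* Solving [F x y z = - (T x (phi y) z + T x y (phi z)) / 2] and
   [T x xi z = - 2 w x z] for a 3-form [T]: the cyclic sum of [form_K] equals
   [T + form_B]. *)
Definition torsion_form x y z : K :=
  form_K x y z + form_K y z x + form_K z x y - form_B x y z.

Lemma torsion_form_skew12 x y z : torsion_form y x z = - torsion_form x y z.
Proof.
rewrite /torsion_form form_B_skew12 (form_K_skew23 y z x) (form_K_skew23 x y z).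
by rewrite (form_K_skew23 z x y); ring.
Qed.

Lemma torsion_form_skew23 x y z : torsion_form x z y = - torsion_form x y z.
Proof.
rewrite /torsion_form form_B_skew23 (form_K_skew23 y z x) (form_K_skew23 x y z).
by rewrite (form_K_skew23 z x y); ring.
Qed.

Let F_xi3 x y : F x y xi = - w x (phi y).
Proof. by rewrite F_skew F_xi. Qed.

(** Here [xi] is the direction of differentiation. Exchanging it with [x] in B, which rests on (i),
    brings it to the slot covered by [F_xi]. *)
Let F_xi1 z x : F xi z (phi x) = w (phi x) (phi z) - w x z.
Proof.
have := form_B_skew12 xi x z; have := form_B_skew23 xi x z.
rewrite /form_B !F_phi_xi1 !F_xi w_xi !w_xi1 w2_phi2; lra.
Qed.

(** For [D = nabla + T/2] this is the equation [D xi = 0]. *)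
Lemma torsion_form_xi x z : torsion_form x xi z = - 2 * w x z.
Proof.
rewrite /torsion_form /form_K /form_B F_xi F_phi_xi3 F_xi1 !F_xi w2_phi2.
by rewrite w_xi w_xi1 eta_xi (wC x z); ring.
Qed.

Let F_xi1E z x : F xi z x = w x (phi z) + w (phi x) z.
Proof.
have := F3_phi2 xi z x; rewrite F_xi1 F_xi3 w_xi1 w_phi2 w_xi1; lra.
Qed.

Let form_K_rot x y z : form_K (phi y) z x + form_K y (phi z) x =
  form_B y z (phi x) + eta z * w y (phi x) + eta x * (w (phi y) z + w y (phi z)).
Proof.
by rewrite /form_K /form_B; have := F_phi y z (phi x); rewrite eta_phi; lra.
Qed.

Let form_B_phi x y z : form_B y z (phi x) - form_B (phi y) z x =
  - eta x * (w y (phi z) + w (phi y) z) - eta y * (w x (phi z) + w (phi x) z).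
Proof.
rewrite /form_B eta_phi F_phi2 F3_phi2 F_xi3 F_xi1E; lra.
Qed.

(** For [D = nabla + T/2] this is [D phi = 0]. The two K-terms with [x] in front give [-2 F];
    [form_K_rot] turns the other pairs into values of B, and [form_B_phi] moves [phi] between their
    slots so that they cancel. *)
Lemma torsion_form_phi x y z :
  torsion_form x (phi y) z + torsion_form x y (phi z) = - 2 * F x y z.
Proof.
have Kx : form_K x (phi y) z + form_K x y (phi z) =
    - 2 * F x y z - eta z * w x (phi y) + eta y * w x (phi z).
  rewrite /form_K; have := F_phi x y (phi z).
  rewrite eta_phi F3_phi2 F_xi3; lra.
rewrite /torsion_form (form_K_skew23 z (phi y) x) (form_K_skew23 (phi z) y x).
have := form_K_rot x y z; have := form_K_rot x z y.
have := form_B_phi x y z; have := form_B_phi x z y.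
have := form_B_skew12 y z (phi x).
have := form_B_skew12 x (phi y) z; have := form_B_skew23 (phi y) x z.
have := form_B_skew23 x y (phi z); have := form_B_skew12 x (phi z) y.
have := form_B_skew23 (phi z) x y.
rewrite (wC (phi x) z) (wC (phi x) y) (wC z (phi x)) (wC y (phi x)).
move: Kx; lra.
Qed.

End pointwise_identities.

Section torsion_identities.
Context {K : realFieldType} {V : Type}.
Variables (phi : V -> V) (P : V -> V -> V -> K).
Hypothesis P_skew12 : forall x y z, P y x z = - P x y z.
Hypothesis P_skew23 : forall x y z, P x z y = - P x y z.

(** [P] stands for [D - nabla], and the hypothesis on [F] for [D phi = 0]. The eight terms cancel in
    pairs under exchange of the first two slots. *)
Lemma class_form_of_skew (F : V -> V -> V -> K) x y z :
  (forall x y z, F x y z = - (P x (phi y) z + P x y (phi z))) ->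
  class_form phi F x y z = 0.
Proof.
move=> FE; rewrite /class_form !FE (P_skew12 (phi x) (phi y)) (P_skew12 x y).
by rewrite (P_skew12 (phi x) y) (P_skew12 x (phi y)); ring.
Qed.

(* Moving [phi] once around the three slots changes the sign. *)
Lemma skew_phi_commuting_eq0 x y z :
  (forall x y z, P x (phi y) z = - P x y (phi z)) -> P (phi x) y z = 0.
Proof.
move=> Pphi; have := Pphi x y z; have := Pphi z x y; have := Pphi y x z.
have := P_skew12 x (phi y) z; have := P_skew23 x (phi y) z.
have := P_skew12 z x (phi y); have := P_skew12 z (phi x) y.
have := P_skew12 y (phi x) z; have := P_skew12 x y (phi z).
have := P_skew23 (phi x) y z; lra.
Qed.

End torsion_identities.

(** Applied to [Q = D - nabla]: both connections are metric, which gives the first hypothesis, and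
    the antisymmetrization of [Q] is the torsion of [D]. *)
Lemma skew_of_antisymmetrization {K : realFieldType} {V : Type}
    (Q : V -> V -> V -> K) :
  (forall x y z, Q x z y = - Q x y z) ->
  (forall x y z, Q x z y - Q z x y = - (Q x y z - Q y x z)) ->
  forall x y z, Q y x z = - Q x y z.
Proof.
move=> Q23 QA x y z; have := Q23 x y z; have := Q23 z x y; have := Q23 y x z.
have := QA x y z; have := QA y x z; have := QA x z y; lra.
Qed.

(** Up to sign the covariant derivative of [eta]; adding the transpose gives the Lie derivative of
    [g] along [xi]. *)
Definition xi_form {R : realType} {n : nat} {M : smooth_manifold R n}
    (nabla : vector_field M -> vector_field M -> vector_field M)
    (xi : vector_field M) (g : vector_field M -> vector_field M -> smooth_fun M)
    x y : smooth_fun M := g (nabla x xi) y.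

(** * Covariant derivatives of the structure tensors *)

Section almost_contact.
Context {R : realType} {n : nat} (M : smooth_manifold R n).
Local Notation X := (vector_field M).
Local Notation A := (smooth_fun M).
Variables (phi : {linear X -> X}) (xi : X) (eta : {scalar X}) (g : X -> X -> A).
Variable nabla : X -> X -> X.
Hypothesis gm : pseudo_riemannian_metric g.
Hypothesis acm : almost_contact_metric phi xi eta g.
Hypothesis LC : levi_civita nabla g.

Local Notation F := (fundamental_tensor nabla phi g).
Local Notation w := (xi_form nabla xi g).

Let gC x y : g x y = g y x. Proof. by case: gm. Qed.

Let gPr x a y z : g x (a *: y + z) = a * g x y + g x z.
Proof. by have [gl _ _] := gm; exact: gl. Qed.

Let gPl x a y z : g (a *: y + z) x = a * g y x + g z x.
Proof. by rewrite gC gPr !(gC x). Qed.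

Let gDl x y z : g (x + y) z = g x z + g y z.
Proof. by rewrite -[x]scale1r gPl mul1r scale1r. Qed.

Let gZl a x y : g (a *: x) y = a * g x y.
Proof.
have g0 : g 0 y = 0 by apply: (addIr (g 0 y)); rewrite -gDl !add0r.
by rewrite -[a *: x]addr0 gPl g0 addr0.
Qed.

Let gNl x y : g (- x) y = - g x y.
Proof. by rewrite -scaleN1r gZl mulN1r. Qed.

Let gDr x y z : g x (y + z) = g x y + g x z.
Proof. by rewrite gC gDl !(gC _ x). Qed.

Let gNr x y : g x (- y) = - g x y.
Proof. by rewrite gC gNl gC. Qed.

Let gZr a x y : g x (a *: y) = a * g x y.
Proof. by rewrite gC gZl gC. Qed.

Let phi2 x : phi (phi x) = - x + eta x *: xi. Proof. by case: acm. Qed.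
Let phi_xi : phi xi = 0. Proof. by case: acm. Qed.
Let eta_phi x : eta (phi x) = 0. Proof. by case: acm. Qed.
Let eta_xi : eta xi = 1. Proof. by case: acm. Qed.
Let g_phiphi x y : g (phi x) (phi y) = g x y + eta x * eta y.
Proof. by case: acm. Qed.

Let g0l x : g 0 x = 0.
Proof. by rewrite -(scale0r 0) gZl mul0r. Qed.

Let g_xi x : g xi x = - eta x.
Proof.
apply/eqP; rewrite -addr_eq0; have := g_phiphi xi x.
by rewrite phi_xi g0l eta_xi mul1r => <-.
Qed.

Let g_phi x y : g (phi x) y = - g x (phi y).
Proof.
have := g_phiphi (phi x) y.
rewrite eta_phi mul0r addr0 phi2 gDl gNl gZl g_xi eta_phi oppr0 mulr0 addr0.
by move=> <-.
Qed.

Let conn : linear_connection nabla. Proof. by case: LC. Qed.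

Let nabla_metric (x y z : X) : x (g y z) = g (nabla x y) z + g y (nabla x z).
Proof.
have [_ H _] := LC; have := H x y z.
by rewrite /cov_metric => /eqP; rewrite -addrA -opprD subr_eq0 => /eqP.
Qed.

Let bracketE x y : bracket x y = nabla x y - nabla y x.
Proof.
have [_ _ H] := LC; have := H x y.
by rewrite /torsion => /eqP; rewrite subr_eq0 => /eqP.
Qed.

Let nablaDr x y z : nabla x (y + z) = nabla x y + nabla x z.
Proof. exact: connectionD. Qed.

Let nabla0 x : nabla x 0 = 0.
Proof. by apply: (addIr (nabla x 0)); rewrite -nablaDr !add0r. Qed.

Let nablaNr x y : nabla x (- y) = - nabla x y.
Proof. by apply/eqP; rewrite -addr_eq0 -nablaDr addNr nabla0. Qed.

Let nablaP y a x z : nabla (a *: x + z) y = a *: nabla x y + nabla z y.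
Proof. exact: (connection_linear conn). Qed.

Let w_eta (x y : X) : cov_form nabla eta x y = - w x y.
Proof.
have etaE z : eta z = - g xi z by rewrite g_xi opprK.
by rewrite /cov_form !etaE derivationN nabla_metric opprK opprD addrNK.
Qed.

Let w_xi x : w x xi = 0.
Proof.
have : x (g xi xi) = 0.
  rewrite g_xi eta_xi (_ : -1 = constant_fun M (-1)) ?derivation_constant//.
  exact: smooth_fun_eq.
rewrite nabla_metric (gC xi) -/(w x xi) => H.
apply: smooth_fun_eq => m; have := congr1 (fun f : A => f m) H.
rewrite smooth_addE -[smooth_fun_val 0 m]/(0 : R); lra.
Qed.

Let FE x y z : F x y z = g (nabla x (phi y)) z + g (nabla x y) (phi z).
Proof. by rewrite /fundamental_tensor /cov_endo gDl gNl g_phi opprK. Qed.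

Let F_skew x y z : F x z y = - F x y z.
Proof.
apply/eqP; rewrite -addr_eq0 !FE.
have H : x (g (phi y) z) + x (g y (phi z)) = 0.
  by rewrite -derivationD g_phi addNr; apply: (addIr (x 0)); rewrite -derivationD !add0r.
rewrite (gC (nabla x (phi z))) (gC (nabla x z)); apply/eqP.
rewrite !nabla_metric in H; rewrite -[RHS]H; ring.
Qed.

(** This is the covariant derivative of the formula for [phi] squared. *)
Let F_phi x y z : F x (phi y) z - F x y (phi z) = w x y * eta z + eta y * w x z.
Proof.
rewrite !FE !phi2 nablaDr nablaNr (connectionM conn) !(gDl, gNl, gZl) !(gDr, gNr, gZr).
have := w_eta x y; rewrite /cov_form => /eqP; rewrite subr_eq => /eqP ->.
rewrite g_xi (gC (nabla x y) xi) g_xi -/(w x z); ring.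
Qed.

Let F_xi x z : F x xi z = w x (phi z).
Proof. by rewrite FE phi_xi nabla0 g0l add0r. Qed.

Let FPl y z a u v : F (a *: u + v) y z = a * F u y z + F v y z.
Proof.
rewrite !FE !nablaP !gPl; ring.
Qed.

(** The two terms containing the derivative of [a] cancel because [phi] is skew for [g]. *)
Let FPm x z a u v : F x (a *: u + v) z = a * F x u z + F x v z.
Proof.
rewrite !FE linearP !nablaDr !(connectionM conn) !(gDl, gZl) g_phi; ring.
Qed.

Let FPr x y a u v : F x y (a *: u + v) = a * F x y u + F x y v.
Proof. exact: gPr. Qed.

Let wPl y a u v : w (a *: u + v) y = a * w u y + w v y.
Proof. by rewrite /xi_form nablaP gPl. Qed.

Let phi2P x : phi (phi x) = eta x *: xi + (- x). Proof. by rewrite phi2 addrC. Qed.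

Let F_phi2 x y z : F (phi (phi x)) y z = - F x y z + eta x * F xi y z.
Proof.
rewrite phi2P FPl (@scalarN_prop _ _ _ (fun u => F u y z)) 1?addrC// => a u v.
exact: FPl.
Qed.

Let F3_phi2 x y z : F x y (phi (phi z)) = - F x y z + eta z * F x y xi.
Proof. by rewrite phi2P FPr /fundamental_tensor gNr addrC. Qed.

Let w_phi2 x y : w (phi (phi x)) y = - w x y + eta x * w xi y.
Proof.
by rewrite phi2P wPl (@scalarN_prop _ _ _ (w^~ y)) 1?addrC// => a u v; exact: wPl.
Qed.

Let w2_phi2 x y : w x (phi (phi y)) = - w x y.
Proof. by rewrite phi2P /xi_form gPr gNr -/(w x xi) w_xi mulr0 add0r. Qed.

Let F_phi_xi1 y z : F (phi xi) y z = 0.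
Proof.
rewrite phi_xi -(scale0r 0) (@scalarZ_prop _ _ _ (fun u => F u y z)) ?mul0r// => a u v.
exact: FPl.
Qed.

Let F_phi_xi3 x y : F x y (phi xi) = 0.
Proof. by rewrite phi_xi /fundamental_tensor gC g0l. Qed.

(** * Transfer of the identities to a point *)

Section at_point.
Variable m : M.
Local Notation Fm := (fun x y z => F x y z m).
Local Notation wm := (fun x y => w x y m).
Local Notation etam := (fun x => eta x m).

Let at_m (f h : A) : f = h -> f m = h m. Proof. by move=> ->. Qed.

Let etam_phi x : eta (phi x) m = 0. Proof. exact: at_m (eta_phi x). Qed.
Let etam_xi : eta xi m = 1. Proof. exact: at_m eta_xi. Qed.
Let Fm_skew x y z : F x z y m = - F x y z m. Proof. exact: at_m (F_skew x y z). Qed.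
Let Fm_phi x y z :
  F x (phi y) z m - F x y (phi z) m = w x y m * eta z m + eta y m * w x z m.
Proof. exact: at_m (F_phi x y z). Qed.
Let Fm_xi x z : F x xi z m = w x (phi z) m. Proof. exact: at_m (F_xi x z). Qed.
Let Fm_phi_xi1 y z : F (phi xi) y z m = 0. Proof. exact: at_m (F_phi_xi1 y z). Qed.
Let Fm_phi_xi3 x y : F x y (phi xi) m = 0. Proof. exact: at_m (F_phi_xi3 x y). Qed.
Let Fm_phi2 x y z : F (phi (phi x)) y z m = - F x y z m + eta x m * F xi y z m.
Proof. exact: at_m (F_phi2 x y z). Qed.
Let Fm3_phi2 x y z : F x y (phi (phi z)) m = - F x y z m + eta z m * F x y xi m.
Proof. exact: at_m (F3_phi2 x y z). Qed.
Let wm_xi x : w x xi m = 0. Proof. exact: at_m (w_xi x). Qed.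
Let wm_phi2 x y : w (phi (phi x)) y m = - w x y m + eta x m * w xi y m.
Proof. exact: at_m (w_phi2 x y). Qed.
Let wm2_phi2 x y : w x (phi (phi y)) m = - w x y m.
Proof. exact: at_m (w2_phi2 x y). Qed.

Lemma skew_w_at x y : (forall x y z, class_form phi Fm x y z = 0) ->
  w x y m + w y x m = 0.
Proof.
by move=> S0; exact: (class_form_skew_w Fm_skew Fm_xi Fm_phi_xi1 Fm_phi_xi3
  wm_phi2 wm2_phi2 S0).
Qed.

Hypothesis skew_w : forall x y, w x y m + w y x m = 0.

Lemma class_of_skew_N x y z :
  (forall x y z, form_B phi etam Fm wm x z y - form_B phi etam Fm wm z x y =
     - (form_B phi etam Fm wm x y z - form_B phi etam Fm wm y x z)) ->
  class_form phi Fm x y z = 0.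
Proof. by move=> H; exact: (form_B_skew12P Fm_skew Fm_phi skew_w H). Qed.

Hypothesis S0 : forall x y z, class_form phi Fm x y z = 0.

Lemma form_B_skew x y z : form_B phi etam Fm wm y x z = - form_B phi etam Fm wm x y z /\
  form_B phi etam Fm wm x z y = - form_B phi etam Fm wm x y z.
Proof.
split; first exact: (form_B_skew12 _ skew_w S0).
exact: (form_B_skew23 Fm_skew Fm_phi).
Qed.

Local Notation T_at := (torsion_form phi etam Fm wm).

Lemma T_at_skew12 x y z : T_at y x z = - T_at x y z.
Proof. exact: (torsion_form_skew12 Fm_skew Fm_phi skew_w S0). Qed.
Lemma T_at_skew23 x y z : T_at x z y = - T_at x y z.
Proof. exact: (torsion_form_skew23 Fm_skew Fm_phi). Qed.
Lemma T_at_xi x z : T_at x xi z = - 2 * w x z m.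
Proof.
exact: (@torsion_form_xi _ _ phi xi etam Fm wm etam_xi
  Fm_skew Fm_phi Fm_xi Fm_phi_xi1 Fm_phi_xi3 wm_xi
  wm2_phi2 skew_w S0).
Qed.
Lemma T_at_phi x y z : T_at x (phi y) z + T_at x y (phi z) = - 2 * F x y z m.
Proof.
exact: (@torsion_form_phi _ _ phi xi etam Fm wm etam_phi
  Fm_skew Fm_phi Fm_xi Fm_phi_xi1 Fm_phi2 Fm3_phi2
  wm_xi wm_phi2 wm2_phi2 skew_w S0).
Qed.

End at_point.

(** * The tensors of statements (i) to (iv) *)

Let lieE x y : lie_derivative_metric xi g x y = w x y + w y x.
Proof.
rewrite /lie_derivative_metric nabla_metric !bracketE gDl gNl gDr gNr /xi_form.
rewrite (gC (nabla y xi) x); ring.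
Qed.

Let phi_braceE x y z : g (phi_brace nabla phi x y) z =
  F (phi x) y z + F (phi y) x z + F x y (phi z) + F y x (phi z).
Proof.
rewrite /phi_brace /brace !(gDl, gNl, g_phi) !FE; ring.
Qed.

Let nijenhuisE x y z : g (nijenhuis nabla phi xi eta x y) z =
  (F (phi x) y z + F x y (phi z) + w x y * eta z) -
  (F (phi y) x z + F y x (phi z) + w y x * eta z).
Proof.
rewrite /nijenhuis /phi_bracket /ext_deriv !w_eta !bracketE.
rewrite !(gDl, gNl, g_phi, gZl) g_xi !FE; ring.
Qed.

Lemma class_killing : class_W2_W4_W9_W10_W11 nabla phi g -> killing xi g.
Proof.
move=> S0 x y; rewrite lieE; apply: smooth_fun_eq => m.
by apply: skew_w_at => a b c; rewrite /class_form -[RHS]/((0 : A) m) -(S0 a b c).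
Qed.

Lemma class_phi_brace :
  class_W2_W4_W9_W10_W11 nabla phi g <-> forall x y, phi_brace nabla phi x y = 0.
Proof.
split=> [S0 x y|b0 x y z]; last by rewrite -phi_braceE b0 g0l.
by apply: (metric_eq0 gm) => z; rewrite phi_braceE.
Qed.


Let skew_w_of_killing : killing xi g -> forall m x y, w x y m + w y x m = 0.
Proof. by move=> K m x y; rewrite -smooth_addE -lieE K. Qed.

Let class_form_at : class_W2_W4_W9_W10_W11 nabla phi g ->
  forall m x y z, class_form phi (fun x y z => F x y z m) x y z = 0.
Proof. by move=> S0 m x y z; rewrite /class_form -[RHS]/((0 : A) m) -(S0 x y z). Qed.

Let wPr x a u v : w x (a *: u + v) = a * w x u + w x v.
Proof. exact: gPr. Qed.

Lemma class_nijenhuis : killing xi g -> class_W2_W4_W9_W10_W11 nabla phi g ->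
  three_form (fun x y z => g (nijenhuis nabla phi xi eta x y) z).
Proof.
move=> K S0; split.
- by move=> y z a u v; rewrite !nijenhuisE linearP !(FPl, FPm, wPl, wPr); ring.
- by move=> x z a u v; rewrite !nijenhuisE linearP !(FPl, FPm, wPl, wPr); ring.
- by move=> x y a u v; exact: gPr.
- by move=> x y z; rewrite !nijenhuisE; ring.
- move=> x y z; rewrite !nijenhuisE; apply: smooth_fun_eq => m.
  have B := form_B_skew (skew_w_of_killing K m) (class_form_at S0 m).
  have [_] := B x y z; have [_] := B z x y; have [+ _] := B x y z; have [+ _] := B y x z.
  have [_] := B y x z; have [+ _] := B x z y; have [+ _] := B z x y.
  rewrite /form_B !(smooth_addE, smooth_mulE, smooth_oppE); lra.
Qed.

Lemma nijenhuis_class : killing xi g ->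
  three_form (fun x y z => g (nijenhuis nabla phi xi eta x y) z) ->
  class_W2_W4_W9_W10_W11 nabla phi g.
Proof.
move=> K [_ _ _ _ N23] x y z; apply: smooth_fun_eq => m.
apply: (class_of_skew_N (skew_w_of_killing K m)) => a b c.
have := congr1 (fun f : A => f m) (N23 a b c); rewrite !nijenhuisE.
by rewrite /form_B !(smooth_addE, smooth_mulE, smooth_oppE).
Qed.

(** * Natural connections with skew-symmetric torsion *)

Section natural.
Variable D : X -> X -> X.
Hypothesis Dnat : natural_connection D phi xi eta g.
Hypothesis Dskew : skew_torsion D g.

Lemma difference_skew23 x y z : g (D x z) y - g (nabla x z) y =
  - (g (D x y) z - g (nabla x y) z).
Proof.
have [_ _ _ _ Dg] := Dnat; have := Dg x y z; rewrite /cov_metric nabla_metric => H.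
apply/eqP; rewrite -subr_eq0 -[X in _ == X]oppr0 -H (gC y) (gC y); apply/eqP; ring.
Qed.

Lemma difference_skew12 x y z : g (D y x) z - g (nabla y x) z =
  - (g (D x y) z - g (nabla x y) z).
Proof.
apply: smooth_fun_eq => m; rewrite smooth_oppE; move: x y z.
apply: (@skew_of_antisymmetrization _ _ (fun x y z => (g (D x y) z - g (nabla x y) z) m)).
  by move=> x y z; rewrite difference_skew23.
move=> x y z; have [_ _ _ _ T23] := Dskew.
have := congr1 (fun f : A => f m) (T23 x y z).
rewrite /torsion !bracketE !(gDl, gNl) !(smooth_addE, smooth_oppE); lra.
Qed.

Lemma natural_cov_endo x y z :
  F x y z = - ((g (D x (phi y)) z - g (nabla x (phi y)) z) +
               (g (D x y) (phi z) - g (nabla x y) (phi z))).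
Proof.
have [_ Dphi _ _ _] := Dnat; have := Dphi x y.
rewrite /cov_endo => /eqP; rewrite subr_eq0 => /eqP ->.
rewrite FE g_phi; ring.
Qed.

Lemma natural_class : class_W2_W4_W9_W10_W11 nabla phi g.
Proof.
move=> x y z; apply: smooth_fun_eq => m.
rewrite -[LHS]/(class_form phi (fun x y z => F x y z m) x y z) -[RHS]/(0 : R).
apply: (@class_form_of_skew _ _ phi (fun x y z => (g (D x y) z - g (nabla x y) z) m)).
- by move=> a b c; rewrite difference_skew12.
- by move=> a b c; rewrite natural_cov_endo.
Qed.

End natural.

(** The difference of the two connections is a 3-form that changes sign when [phi] moves between its
    last two slots, so it vanishes on the image of [phi]. It also vanishes on [xi], and the two
    span. *)
Lemma natural_unique D D' :
  natural_connection D phi xi eta g -> skew_torsion D g ->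
  natural_connection D' phi xi eta g -> skew_torsion D' g -> D = D'.
Proof.
move=> Dn Ds D'n D's; apply/funext => x; apply/funext => y; apply: (metric_eq gm) => z.
apply: smooth_fun_eq => m; pose P x y z : R := g (D x y) z m - g (D' x y) z m.
have P12 a b c : P b a c = - P a b c.
  have := congr1 (fun f : A => f m) (difference_skew12 Dn Ds a b c).
  have := congr1 (fun f : A => f m) (difference_skew12 D'n D's a b c).
  rewrite /P !(smooth_addE, smooth_oppE); lra.
have P23 a b c : P a c b = - P a b c.
  have := congr1 (fun f : A => f m) (difference_skew23 Dn a b c).
  have := congr1 (fun f : A => f m) (difference_skew23 D'n a b c).
  rewrite /P !(smooth_addE, smooth_oppE); lra.
have Pphi a b c : P a (phi b) c = - P a b (phi c).
  have := congr1 (fun f : A => f m) (natural_cov_endo Dn a b c).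
  have := congr1 (fun f : A => f m) (natural_cov_endo D'n a b c).
  rewrite /P !(smooth_addE, smooth_oppE); lra.
have P0 a b c : P (phi a) b c = 0 by exact: skew_phi_commuting_eq0.
have Pxi a b : P a xi b = 0.
  have [_ _ Dxi _ _] := Dn; have [_ _ D'xi _ _] := D'n.
  by rewrite /P Dxi D'xi subrr.
have P3 a b c : P a b (phi c) = 0 by rewrite P23 P12 P0 !oppr0.
have Exi : g (D x y) xi m = g (D' x y) xi m.
  by apply/eqP; rewrite -subr_eq0 -[X in X == _]/(P x y xi) P23 Pxi oppr0.
have := P3 x y (phi z); rewrite /P phi2 !(gDr, gNr, gZr).
rewrite !(smooth_addE, smooth_oppE, smooth_mulE) Exi; lra.
Qed.

Let torsion3 x y z : A :=
  (F x y (phi z) + w x y * eta z) + (F y z (phi x) + w y z * eta x) +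
  (F z x (phi y) + w z x * eta y) - (F (phi x) y z + F x y (phi z) + w x y * eta z).

Lemma natural_exists : class_W2_W4_W9_W10_W11 nabla phi g ->
  exists D, natural_connection D phi xi eta g /\ skew_torsion D g.
Proof.
move=> S0; have K := class_killing S0.
have tE m x y z : torsion3 x y z m =
  torsion_form phi (fun x => eta x m) (fun x y z => F x y z m) (fun x y => w x y m) x y z.
  by [].
have S0m := class_form_at S0; have wm := skew_w_of_killing K.
have t12 x y z : torsion3 y x z = - torsion3 x y z.
  by apply: smooth_fun_eq => m; rewrite smooth_oppE !tE; exact: T_at_skew12.
have t23 x y z : torsion3 x z y = - torsion3 x y z.
  by apply: smooth_fun_eq => m; rewrite smooth_oppE !tE; exact: T_at_skew23.
have t_xi m x z : torsion3 x xi z m = - 2 * w x z m by rewrite tE; exact: T_at_xi.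
have t_phi m x y z : torsion3 x (phi y) z m + torsion3 x y (phi z) m = - 2 * F x y z m.
  by rewrite !tE; exact: T_at_phi.
(* Linearity is computed in the last slot and carried to the others by skew-symmetry. *)
have tl3 x y : scalar (torsion3 x y).
  move=> a u v; rewrite /torsion3 !linearP !(FPl, FPm, FPr, wPl, wPr); ring.
have tl2 x z : scalar (fun y => torsion3 x y z).
  by move=> a u v; rewrite ![torsion3 _ _ z]t23 tl3; ring.
have tl1 y z : scalar (fun x => torsion3 x y z).
  by move=> a u v; rewrite ![torsion3 _ y z]t12 tl2; ring.
(* The musical isomorphism turns the 3-form into a vector-valued torsion, one pair of fields at a
   time. *)
have /choice[T0 T0E] (xy : X * X) : exists t, forall z, g t z = torsion3 xy.1 xy.2 z.
  exact: (sharp gm (tl3 _ _)).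
pose T x y := T0 (x, y); have TE x y z : g (T x y) z = torsion3 x y z by exact: T0E.
pose h : A := constant_fun M 2^-1.
have hE m : h m = 2^-1 by [].
have [D gD] : exists D : X -> X -> X, forall x y z,
    g (D x y) z = g (nabla x y) z + h * torsion3 x y z.
  by exists (fun x y => nabla x y + h *: T x y) => x y z; rewrite gDl gZl TE.
have Dconn : linear_connection D.
  split.
  - move=> y a u v; apply: (metric_eq gm) => z.
    by rewrite gPl !gD nablaP gPl tl1; ring.
  - move=> x y z; apply: (metric_eq gm) => t.
    have := tl2 x t 1 y z; rewrite scale1r mul1r => E.
    by rewrite gDl !gD nablaDr gDl E; ring.
  - move=> x f y; apply: (metric_eq gm) => t.
    rewrite gDl !gZl !gD (connectionM conn) gDl !gZl.
    by rewrite (@scalarZ_prop _ _ _ (fun y => torsion3 x y t))//; ring.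
have Dmetric x y z : cov_metric D g x y z = 0.
  by rewrite /cov_metric nabla_metric gD (gC y (D x z)) gD (gC y) t23; ring.
have Dxi x : D x xi = 0.
  apply: (metric_eq gm) => z; rewrite g0l gD; apply: smooth_fun_eq => m.
  rewrite smooth_addE smooth_mulE t_xi hE -[RHS]/(0 : R) /xi_form; lra.
have Dtor x y : torsion D x y = T x y.
  apply: (metric_eq gm) => z.
  rewrite /torsion !(gDl, gNl, gZl) bracketE gDl gNl !gD !TE (t12 x y).
  apply: smooth_fun_eq => m; rewrite !(smooth_addE, smooth_oppE, smooth_mulE) hE; lra.
exists D; split.
- split => //.
  + move=> x y; apply: (metric_eq gm) => z; rewrite g0l /cov_endo gDl gNl g_phi !gD.
    apply: smooth_fun_eq => m; rewrite -[RHS]/(0 : R); have := t_phi m x y z.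
    rewrite FE !(smooth_addE, smooth_oppE, smooth_mulE) hE; lra.
  (* As [eta] is [- g xi], [D eta = 0] follows from [D g = 0] and [D xi = 0]. *)
  + move=> x y; apply: oppr_inj; rewrite oppr0 -[RHS](Dmetric x xi y).
    rewrite /cov_metric /cov_form Dxi g0l !g_xi derivationN; ring.
- have E : (fun x y z => g (torsion D x y) z) = torsion3.
    by apply/funext => x; apply/funext => y; apply/funext => z; rewrite Dtor TE.
  by rewrite /skew_torsion E; split.
Qed.

End almost_contact.

(** * The cycle of implications *)

Theorem theorem8 (R : realType) (n : nat) (M : smooth_manifold R n)
    (phi : {linear vector_field M -> vector_field M})
    (xi : vector_field M)
    (eta : {scalar vector_field M})
    (g : vector_field M -> vector_field M -> smooth_fun M)
    (nabla : vector_field M -> vector_field M -> vector_field M)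
    (g_metric : pseudo_riemannian_metric g)
    (acm : almost_contact_metric phi xi eta g)
    (nabla_LC : levi_civita nabla g) :
  [<->
    (* (i) *)
    class_W2_W4_W9_W10_W11 nabla phi g;
    (* (ii) *)
    (forall x y, assoc_nijenhuis nabla phi xi g x y = 0) /\ killing xi g;
    (* (iii) *)
    (forall x y, phi_brace nabla phi x y = 0) /\ killing xi g;
    (* (iv) *)
    three_form (fun x y z => g (nijenhuis nabla phi xi eta x y) z)
      /\ killing xi g;
    (* (v) *)
    exists! D : vector_field M -> vector_field M -> vector_field M,
      natural_connection D phi xi eta g /\ skew_torsion D g
  ].
Proof.
have braceP := class_phi_brace nabla g_metric acm.
have assocE x y : killing xi g ->
    assoc_nijenhuis nabla phi xi g x y = phi_brace nabla phi x y.
  by move=> K; rewrite /assoc_nijenhuis K scale0r subr0.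
tfae.
- move=> S0; have K := class_killing g_metric acm nabla_LC S0.
  by split => // x y; rewrite assocE//; exact: braceP.1.
- by move=> [N0 K]; split => // x y; rewrite -assocE.
- move=> [b0 K]; split => //; apply: class_nijenhuis => //; exact: braceP.2.
- move=> [N3 K]; have S0 := nijenhuis_class g_metric acm nabla_LC K N3.
  have [D [Dn Ds]] := natural_exists g_metric acm nabla_LC S0.
  exists D; split => // D' [D'n D's].
  exact: (natural_unique g_metric acm nabla_LC Dn Ds D'n D's).
- move=> [D [[Dn Ds] _]]; exact: (natural_class g_metric acm nabla_LC Dn Ds).
Qed.
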